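(* Fix $I,J\in\mathbb S$ with $I\perp J$. For $f\in\mathcal{SR}(\mathbb H)$ write $f_I=F+GJ$ with $F,G:\mathbb C_I\to\mathbb C_I$ entire, and define the matrix-valued function $$\Phi_I(f)(z):=\begin{pmatrix}F(z)&G(z)\\-G^\#(z)&F^\#(z)\end{pmatrix},\qquad z\in\mathbb C_I.$$ Set $$\mathcal M_I:=\left\{\begin{pmatrix}U&V\\-V^\#&U^\#\end{pmatrix}:\ U,V\in\mathcal O(\mathbb C_I)\right\}.$$ Then $\Phi_I:(\mathcal{SR}(\mathbb H),\star)\to\mathcal M_I$ is a multiplicative real-linear isomorphism onto $\mathcal M_I$, where $\mathcal M_I$ is endowed with pointwise matrix multiplication.
   Context: $\mathbb H$ denotes the quaternions, $\mathbb S=\{I\in\mathbb H: I^2=-1\}$, and for $I\in\mathbb S$, $\mathbb C_I=\{x+yI: x,y\in\mathbb R\}$. $J\perp I$ means orthogonality of imaginary units (so $IJ=-JI$). A real differentiable $f:\mathbb H\to\mathbb H$ is slice regular if for every $I\in\mathbb S$ the restriction $f_I:=f|_{\mathbb C_I}$ satisfies $\frac12(\partial_x+I\partial_y)f_I(x+yI)=0$; $\mathcal{SR}(\mathbb H)$ is the class of such functions. For $J\perp I$, each $f\in\mathcal{SR}(\mathbb H)$ splits uniquely as $f_I=F+GJ$ with $F,G:\mathbb C_I\to\mathbb C_I$ holomorphic. Every $f\in\mathcal{SR}(\mathbb H)$ has a power series $f(\xi)=\sum_{n\ge0}\xi^na_n$, $a_n\in\mathbb H$; for $f=\sum\xi^na_n$,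 $g=\sum\xi^nb_n$ the $\star$-product is $(f\star g)(\xi)=\sum_n\xi^n\sum_{k=0}^na_kb_{n-k}$. $\mathcal O(\mathbb C_I)$ is the space of holomorphic $\mathbb C_I$-valued functions on $\mathbb C_I$, and $D^\#(z)=\overline{D(\overline z)}$. *)

(* Defs.v *)
From Stdlib Require Import Reals Lra Psatz ClassicalEpsilon.
From Coquelicot Require Import Coquelicot.

Open Scope R_scope.

(** [(a, b, c, d)] stands for [a + b i + c j + d k].  Addition, real scaling,
    norm and topology are those of Coquelicot's product spaces (the norm is the
    Euclidean one); only the multiplication is new. *)
Definition H : Type := (R * R * R * R)%type.

Canonical H_UniformSpace :=
  UniformSpace.Pack H (UniformSpace.class
    (prod_UniformSpace (prod_UniformSpace (prod_UniformSpace R_UniformSpace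
       R_UniformSpace) R_UniformSpace) R_UniformSpace)) H.

Canonical H_AbelianMonoid :=
  AbelianMonoid.Pack H (AbelianMonoid.class
    (prod_AbelianMonoid (prod_AbelianMonoid (prod_AbelianMonoid
       R_AbelianMonoid R_AbelianMonoid) R_AbelianMonoid) R_AbelianMonoid)) H.

Canonical H_AbelianGroup :=
  AbelianGroup.Pack H (AbelianGroup.class
    (prod_AbelianGroup (prod_AbelianGroup (prod_AbelianGroup
       R_AbelianGroup R_AbelianGroup) R_AbelianGroup) R_AbelianGroup)) H.

Canonical H_ModuleSpace :=
  ModuleSpace.Pack R_Ring H (ModuleSpace.class R_Ring
    (prod_ModuleSpace R_Ring (prod_ModuleSpace R_Ring (prod_ModuleSpace R_Ring
       R_ModuleSpace R_ModuleSpace) R_ModuleSpace) R_ModuleSpace)) H.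

Canonical H_NormedModuleAux :=
  NormedModuleAux.Pack R_AbsRing H (NormedModuleAux.class R_AbsRing
    (prod_NormedModuleAux R_AbsRing (prod_NormedModuleAux R_AbsRing
       (prod_NormedModuleAux R_AbsRing R_NormedModuleAux R_NormedModuleAux)
       R_NormedModuleAux) R_NormedModuleAux)) H.

Canonical H_NormedModule :=
  NormedModule.Pack R_AbsRing H (NormedModule.class R_AbsRing
    (prod_NormedModule R_AbsRing (prod_NormedModule R_AbsRing
       (prod_NormedModule R_AbsRing R_NormedModule R_NormedModule)
       R_NormedModule) R_NormedModule)) H.

Definition Hmult (p q : H) : H :=
  let '(a, b, c, d) := p in
  let '(a', b', c', d') := q in
  (a * a' - b * b' - c * c' - d * d',
   a * b' + b * a' + c * d' - d * c',
   a * c' - b * d' + c * a' + d * b',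
   a * d' + b * c' - c * b' + d * a').

Definition RtoH (x : R) : H := (x, 0, 0, 0).

Definition Hconj (q : H) : H :=
  let '(a, b, c, d) := q in (a, - b, - c, - d).

Definition Hdot (p q : H) : R :=
  let '(a, b, c, d) := p in
  let '(a', b', c', d') := q in
  a * a' + b * b' + c * c' + d * d'.

Lemma H_plusE (a b c d a' b' c' d' : R) :
  plus ((a, b, c, d) : H) ((a', b', c', d') : H) =
  (a + a', b + b', c + c', d + d').
Proof. reflexivity. Qed.

Lemma H_scalE (x a b c d : R) :
  scal x ((a, b, c, d) : H) = (x * a, x * b, x * c, x * d).
Proof. reflexivity. Qed.

Definition H_Ring_mixin : Ring.mixin_of H_AbelianGroup.
Proof.
apply (Ring.Mixin H_AbelianGroup Hmult (RtoH 1)).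
- intros [[[a b] c] d] [[[a' b'] c'] d'] [[[a'' b''] c''] d''].
  unfold Hmult; repeat apply (f_equal2 (@pair _ _)); ring.
- intros [[[a b] c] d].
  unfold Hmult, RtoH; repeat apply (f_equal2 (@pair _ _)); ring.
- intros [[[a b] c] d].
  unfold Hmult, RtoH; repeat apply (f_equal2 (@pair _ _)); ring.
- intros [[[a b] c] d] [[[a' b'] c'] d'] [[[a'' b''] c''] d''].
  rewrite !H_plusE; unfold Hmult; rewrite H_plusE; repeat apply (f_equal2 (@pair _ _)); ring.
- intros [[[a b] c] d] [[[a' b'] c'] d'] [[[a'' b''] c''] d''].
  rewrite !H_plusE; unfold Hmult; rewrite H_plusE; repeat apply (f_equal2 (@pair _ _)); ring.
Defined.

Canonical H_Ring :=
  Ring.Pack H (Ring.Class H (AbelianGroup.class H_AbelianGroup) H_Ring_mixin) H.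

Definition Sph : Type := {I : H | mult I I = opp one}.
Definition Sph_val (I : Sph) : H := proj1_sig I.
Coercion Sph_val : Sph >-> H.

Definition orthogonal (I J : H) : Prop := Hdot I J = 0.

Definition slice (I : H) (x y : R) : H := plus (RtoH x) (scal y I).

Definition CI (I : H) : Type := {z : H | exists x y : R, z = slice I x y}.
Definition CI_val (I : H) (z : CI I) : H := proj1_sig z.
Coercion CI_val : CI >-> H.

Definition CI_of_C (I : H) (z : C) : CI I :=
  exist _ (slice I (fst z) (snd z))
    (ex_intro _ (fst z) (ex_intro _ (snd z) eq_refl)).

Lemma CI_conj_proof (I : Sph) (z : CI I) :
  exists x y : R, Hconj z = slice I x y.
Proof.
destruct I as [[[[a b] c] d] HI], z as [z [x [y Hz]]]; simpl in *.
exists x, (- y).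
rewrite Hz; clear z Hz; change (Hmult (a, b, c, d) (a, b, c, d) = (- (1), - 0, - 0, - 0)) in HI.
injection HI; intros H3 H2 H1 H0.
assert (Ha : a = 0).
{ destruct (Req_dec a 0) as [|Ha]; [assumption|exfalso].
  assert (b = 0) by (apply (Rmult_eq_reg_l a); lra).
  assert (c = 0) by (apply (Rmult_eq_reg_l a); lra).
  assert (d = 0) by (apply (Rmult_eq_reg_l a); lra).
  subst; nra. }
unfold slice; rewrite !H_scalE; unfold RtoH; rewrite !H_plusE; unfold Hconj.
subst a; repeat apply (f_equal2 (@pair _ _)); ring.
Qed.

Definition CI_conj {I : Sph} (z : CI I) : CI I :=
  exist _ (Hconj z) (CI_conj_proof I z).

(** [D^#(z) = conj (D (conj z))]. *)
Definition sharp {I : Sph} (D : CI I -> H) : CI I -> H :=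
  fun z => Hconj (D (CI_conj z)).

(** [F : C_I -> C_I] is entire: under the identification of [C_I] with [C]
    sending [x + y I] to [x + i y], it is a function [C -> C] which is
    complex-differentiable everywhere.  In particular [F] is [C_I]-valued,
    although its codomain is declared to be [H]. *)
Definition entire (I : H) (F : CI I -> H) : Prop :=
  exists phi : C -> C,
    (forall z : C, ex_derive (K := C_AbsRing) (V := C_NormedModule) phi z) /\
    (forall z : C, F (CI_of_C I z) = CI_of_C I (phi z)).

Definition real_differentiable (f : H -> H) : Prop :=
  forall q : H,
    ex_filterdiff (K := R_AbsRing) (U := H_NormedModule) (V := H_NormedModule)
      f (locally q).

(** [dx] and [dy] are the partial derivatives of [f_I] at [x + y I]. *)
Definition slice_regular (f : H -> H) : Prop :=
  real_differentiable f /\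
  forall (I : Sph) (x y : R),
    exists dx dy : H,
      is_derive (K := R_AbsRing) (V := H_NormedModule)
        (fun t : R => f (slice I t y)) x dx /\
      is_derive (K := R_AbsRing) (V := H_NormedModule)
        (fun t : R => f (slice I x t)) y dy /\
      scal (1 / 2) (plus dx (mult (I : H) dy)) = (zero : H).

Definition is_power_series (f : H -> H) (a : nat -> H) : Prop :=
  forall xi : H,
    is_series (K := R_AbsRing) (V := H_NormedModule)
      (fun n => mult (pow_n xi n) (a n)) (f xi).

(** The coefficients of the power series of [f] (arbitrary if there is none). *)
Definition coeff (f : H -> H) : nat -> H :=
  epsilon (inhabits (fun _ => zero)) (is_power_series f).

(** The sum of a series in [H] (arbitrary if it diverges). *)
Definition Hseries (u : nat -> H) : H :=
  epsilon (inhabits zero)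
    (is_series (K := R_AbsRing) (V := H_NormedModule) u).

Definition star (f g : H -> H) : H -> H :=
  fun xi => Hseries (fun n =>
    mult (pow_n xi n)
      (sum_n (fun k => mult (coeff f k) (coeff g (n - k)%nat)) n)).

Definition mat2 (a b c d : H) : @matrix H 2 2 :=
  mk_matrix 2 2 (fun i j =>
    match i, j with
    | O, O => a
    | O, _ => b
    | _, O => c
    | _, _ => d
    end).

(** Entrywise multiplication by a real scalar ([matrix_ModuleSpace] only provides
    scalars in the ring of the entries). *)
Definition Rscal_mat (a : R) (A : @matrix H 2 2) : @matrix H 2 2 :=
  mk_matrix 2 2 (fun i j => scal a (coeff_mat (zero : H) A i j)).

(** The matrix function with rows [(U, V)] and [(- V^#, U^#)]. *)
Definition sharp_matrix {I : Sph} (U V : CI I -> H) : CI I -> @matrix H 2 2 :=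
  fun z => mat2 (U z) (V z) (opp (sharp V z)) (sharp U z).

Definition M_ (I : Sph) (A : CI I -> @matrix H 2 2) : Prop :=
  exists U V : CI I -> H, entire I U /\ entire I V /\ A = sharp_matrix U V.

(** [f_I = F + G J] with [F, G : C_I -> C_I] entire. *)
Definition splits (I J : Sph) (f : H -> H) (F G : CI I -> H) : Prop :=
  entire I F /\ entire I G /\
  forall z : CI I, f z = plus (F z) (mult (G z) (J : H)).

(** The pair [(F, G)] of the splitting of [f] (arbitrary if there is none). *)
Definition splitting (I J : Sph) (f : H -> H) : (CI I -> H) * (CI I -> H) :=
  epsilon (inhabits (fun _ => zero, fun _ => zero))
    (fun FG => splits I J f (fst FG) (snd FG)).

Definition Phi (I J : Sph) (f : H -> H) : CI I -> @matrix H 2 2 :=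
  let (F, G) := splitting I J f in sharp_matrix F G.

(* Main.v *)
Require Import Defs.
From Stdlib Require Import Reals Lra Lia Psatz ClassicalEpsilon FunctionalExtensionality.
From Coquelicot Require Import Coquelicot.
From Corelib Require Import ssreflect.

(** The two components of a slice regular function on [C_I] are entire, and complex
    differentiability alone (Goursat's bisection, then Cauchy's formula) gives them Taylor
    series that converge everywhere.  The coefficients can be read off on the real axis, which
    all slices share; hence a slice regular function is one power series [sum q^n a_n], and it
    is determined by its values on the real axis.

    Conversely, the real differential of such a power series at a point [q] of [C_I] is
    [L h = sum_n sum_i q^i h q^(n-1-i) a_n], and [L I = I (L 1)] because [I] commutes with
    [q]; this is the equation of slice regularity, whence surjectivity.

    Real numbers are central, so the star product is the pointwise product on the real axis.
    The slice regular function that splits as [(F F' - G G'^#) + (F G' + G F'^#) J] has the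
    same values there, hence it is the star product; its components are the first row of the
    product of the two matrices. *)

(** * Goursat's lemma *)

(** Differentiability comes without continuity of the differential, so Green's theorem is not at
    hand. Goursat's bisection is run for closed forms [k ds + g dt] on parameter rectangles rather
    than on regions of the plane: in the coordinates [z = w + e^s (r cis t - w)] the form
    [f(z) dz / (z - w)] is closed as soon as [f] is complex differentiable, and one rectangle moves
    the integral over a circle towards [w]. Only functions vanishing at [w] are treated, namely
    [f - f w], so the winding integral of [dz / (z - w)] is never evaluated.

    The matrix comes from the usual representation of [z + w J] by the rows [(z, w)] and
    [(- conj w, conj z)], multiplicative because [J z = conj z J]. At a real point [D^#] is the
    conjugate of [D], so the matrix there represents the quaternion [f(x)]; off the real axis [#]
    replaces conjugation in order to keep the entries holomorphic.

    [coeff], [Hseries] and [splitting] are choices; each needs a uniqueness statement before it can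
    be computed. *)

Lemma minus_plus_plus {G : AbelianGroup} (x1 x2 y1 y2 : G) :
  minus (plus x1 x2) (plus y1 y2) = plus (minus x1 y1) (minus x2 y2).
Proof.
unfold minus; rewrite opp_plus -!plus_assoc; f_equal.
rewrite !plus_assoc; f_equal; apply plus_comm.
Qed.

Lemma minus_telescope {G : AbelianGroup} (x y z : G) :
  minus x z = plus (minus y z) (minus x y).
Proof.
rewrite plus_comm; unfold minus; rewrite -plus_assoc (plus_assoc (opp _)).
now rewrite plus_opp_l plus_zero_l.
Qed.

Section Circulation.

Context {V : CompleteNormedModule R_AbsRing}.
Variables k g : R -> R -> V.

(** The integral of the form [k ds + g dt] around the boundary of a rectangle, with opposite sides
    paired so that only increments across the rectangle occur. *)
Definition circulation (a b c d : R) : V :=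
  minus (RInt (fun t => minus (g b t) (g a t)) c d)
        (RInt (fun s => minus (k s d) (k s c)) a b).

Hypothesis k_continuous : forall s t, continuous (fun s => k s t) s.
Hypothesis g_continuous : forall s t, continuous (fun t => g s t) t.

Lemma ex_RInt_minus_g (a b c d : R) :
  ex_RInt (fun t => minus (g b t) (g a t)) c d.
Proof.
apply (ex_RInt_continuous (V := V)); intros t _.
apply (continuous_minus (V := V)); apply g_continuous.
Qed.

Lemma ex_RInt_minus_k (a b c d : R) :
  ex_RInt (fun s => minus (k s d) (k s c)) a b.
Proof.
apply (ex_RInt_continuous (V := V)); intros t _.
apply (continuous_minus (V := V)); apply k_continuous.
Qed.

Lemma circulation_split_s (a m b c d : R) :
  circulation a b c d = plus (circulation a m c d) (circulation m b c d).
Proof.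
unfold circulation; rewrite -(minus_plus_plus (G := V)); f_equal.
- rewrite -RInt_plus; [|apply ex_RInt_minus_g|apply ex_RInt_minus_g].
  apply RInt_ext; intros t _; exact (@minus_telescope V _ (g m t) _).
- symmetry; apply RInt_Chasles; apply ex_RInt_minus_k.
Qed.

Lemma circulation_split_t (a b c m d : R) :
  circulation a b c d = plus (circulation a b c m) (circulation a b m d).
Proof.
unfold circulation; rewrite -(minus_plus_plus (G := V)); f_equal.
- symmetry; apply RInt_Chasles; apply ex_RInt_minus_g.
- rewrite -RInt_plus; [|apply ex_RInt_minus_k|apply ex_RInt_minus_k].
  apply RInt_ext; intros t _; exact (@minus_telescope V _ (k t m) _).
Qed.

Definition rect : Type := ((R * R) * (R * R))%type.

Definition rect_circulation (Q : rect) : R :=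
  let '((a, b), (c, d)) := Q in norm (circulation a b c d).

Definition larger (P Q : rect) : rect :=
  if Rle_dec (rect_circulation Q) (rect_circulation P) is left _ then P else Q.

Definition bisect_s (Q : rect) : rect :=
  let '((a, b), (c, d)) := Q in
  larger ((a, (a + b) / 2), (c, d)) (((a + b) / 2, b), (c, d)).

Definition bisect_t (Q : rect) : rect :=
  let '((a, b), (c, d)) := Q in
  larger ((a, b), (c, (c + d) / 2)) ((a, b), ((c + d) / 2, d)).

Lemma larger_ge (P Q : rect) (x : R) :
  x <= rect_circulation P + rect_circulation Q ->
  x <= 2 * rect_circulation (larger P Q).
Proof. unfold larger; destruct Rle_dec; lra. Qed.

(** The common side of the two halves cancels, so their circulations add up and the larger one
    carries at least half of the norm. *)
Lemma bisect_s_ge (Q : rect) :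
  rect_circulation Q <= 2 * rect_circulation (bisect_s Q).
Proof.
destruct Q as [[a b] [c d]]; apply larger_ge; simpl.
rewrite (circulation_split_s a ((a + b) / 2) b c d).
exact (@norm_triangle R_AbsRing V _ _).
Qed.

Lemma bisect_t_ge (Q : rect) :
  rect_circulation Q <= 2 * rect_circulation (bisect_t Q).
Proof.
destruct Q as [[a b] [c d]]; apply larger_ge; simpl.
rewrite (circulation_split_t a b c ((c + d) / 2) d).
exact (@norm_triangle R_AbsRing V _ _).
Qed.

Definition bisect (Q : rect) : rect := bisect_t (bisect_s Q).

Definition half_of (I' I : R * R) : Prop :=
  fst I <= fst I' /\ snd I' <= snd I /\ 2 * (snd I' - fst I') = snd I - fst I.

Lemma bisect_half (Q : rect) :
  fst (fst Q) <= snd (fst Q) -> fst (snd Q) <= snd (snd Q) ->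
  half_of (fst (bisect Q)) (fst Q) /\ half_of (snd (bisect Q)) (snd Q).
Proof.
destruct Q as [[a b] [c d]]; simpl; intros Hab Hcd.
unfold bisect, bisect_s, larger; destruct Rle_dec;
unfold bisect_t, larger; destruct Rle_dec; unfold half_of; simpl; lra.
Qed.

Definition nest (Q : rect) (n : nat) : rect := Nat.iter n bisect Q.

(** One halving in each direction costs at most a factor 2 each; the resulting 4 is exactly
    compensated by the quadratic smallness of the circulation around a small rectangle. *)
Lemma nest_ge (Q : rect) (n : nat) :
  rect_circulation Q <= 4 ^ n * rect_circulation (nest Q n).
Proof.
induction n as [|n IH]; simpl; [lra|].
set (P := nest Q n) in *; change (Nat.iter n bisect Q) with P.
assert (H1 := bisect_s_ge P); assert (H2 := bisect_t_ge (bisect_s P)).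
unfold bisect.
assert (0 < 4 ^ n) by (apply pow_lt; lra).
nra.
Qed.

Lemma nested_intervals (J : nat -> R * R) :
  fst (J 0%nat) <= snd (J 0%nat) ->
  (forall n, fst (J n) <= snd (J n) -> half_of (J (S n)) (J n)) ->
  (forall n, snd (J n) - fst (J n) = (snd (J 0%nat) - fst (J 0%nat)) / 2 ^ n) /\
  exists x, forall n, fst (J n) <= x <= snd (J n).
Proof.
intros H0 Hs.
assert (Hle : forall n, fst (J n) <= snd (J n)).
{ induction n as [|n IH]; [assumption|].
  destruct (Hs n IH) as [_ [_ H]]; lra. }
assert (Hmono : forall n p, fst (J n) <= fst (J (n + p)%nat) /\ snd (J (n + p)%nat) <= snd (J n)).
{ intros n; induction p as [|p IH].
  - rewrite Nat.add_0_r; lra.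
  - rewrite Nat.add_succ_r. destruct (Hs _ (Hle (n + p)%nat)) as [H1 [H2 _]]; lra. }
split.
- induction n as [|n IH]; [simpl; field|].
  destruct (Hs n (Hle n)) as [_ [_ H]]. simpl.
  apply (Rmult_eq_reg_l 2); [|lra].
  rewrite H IH; field; apply pow_nonzero; lra.
- assert (Hcross : forall n m, fst (J n) <= snd (J m)).
  { intros n m. destruct (Hmono n m) as [H1 _], (Hmono m n) as [_ H2].
    rewrite Nat.add_comm in H2. specialize (Hle (n + m)%nat); lra. }
  destruct (completeness (fun y => exists n, y = fst (J n))) as [x [Hub Hlub]].
  + exists (snd (J 0%nat)); intros y [n ->]; apply Hcross.
  + exists (fst (J 0%nat)), 0%nat; reflexivity.
  + exists x; intros n; split; [apply Hub; now exists n|].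
    apply Hlub; intros y [m ->]; apply Hcross.
Qed.

(** Closedness at a single point: [l] is the common value of the derivative of [g] in [s] and of [k]
    in [t]. It is phrased through increments across small rectangles around the point, which is all
    that the bisection sees; nothing is asked about how [l] varies. *)
Hypothesis locally_closed : forall s0 t0, exists l : V, forall eps, 0 < eps ->
  exists delta, 0 < delta /\ forall a b c d s t,
    a <= s0 <= b -> c <= t0 <= d -> b - a < delta -> d - c < delta ->
    a <= s <= b -> c <= t <= d ->
    norm (minus (minus (g b t) (g a t)) (scal (b - a) l)) <= eps * (b - a + (d - c)) /\
    norm (minus (minus (k s d) (k s c)) (scal (d - c) l)) <= eps * (b - a + (d - c)).

(** The linear parts integrate to [(b - a) (d - c) l] on both pairs of sides and cancel; only the
    two errors, of size [M] each, are left. *)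
Lemma circulation_estimate (l : V) (a b c d M : R) :
  a <= b -> c <= d ->
  (forall t, c <= t <= d ->
     norm (minus (minus (g b t) (g a t)) (scal (b - a) l)) <= M) ->
  (forall s, a <= s <= b ->
     norm (minus (minus (k s d) (k s c)) (scal (d - c) l)) <= M) ->
  norm (circulation a b c d) <= (d - c + (b - a)) * M.
Proof.
intros Hab Hcd Hg Hk.
assert (Ig := is_RInt_minus _ _ _ _ _ _
  (RInt_correct _ _ _ (ex_RInt_minus_g a b c d)) (is_RInt_const c d (scal (b - a) l))).
assert (Ik := is_RInt_minus _ _ _ _ _ _
  (RInt_correct _ _ _ (ex_RInt_minus_k a b c d)) (is_RInt_const a b (scal (d - c) l))).
apply norm_RInt_le_const with (M := M) in Ig; [|assumption|assumption].
apply norm_RInt_le_const with (M := M) in Ik; [|assumption|assumption].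
rewrite Rmult_plus_distr_r.
refine (Rle_trans _ _ _ _ (Rplus_le_compat _ _ _ _ Ig Ik)).
rewrite -(norm_opp (minus (RInt (fun s => _) a b) _)).
refine (Rle_trans _ _ _ _ (@norm_triangle R_AbsRing V _ _)).
apply Req_le; f_equal; unfold circulation.
rewrite opp_minus.
assert (E : scal (b - a) (scal (d - c) l) = scal (d - c) (scal (b - a) l)).
{ rewrite !scal_assoc; f_equal; apply Rmult_comm. }
rewrite E; unfold minus.
rewrite -plus_assoc; f_equal.
now rewrite plus_assoc plus_opp_l plus_zero_l.
Qed.

Lemma goursat (a b c d : R) : a <= b -> c <= d -> circulation a b c d = zero.
Proof.
intros Hab Hcd; apply (@norm_eq_zero R_AbsRing V).
set (Q := ((a, b), (c, d))).
change (rect_circulation Q = 0).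
assert (HE : 0 <= rect_circulation Q) by apply norm_ge_0.
assert (Hle : forall n, fst (fst (nest Q n)) <= snd (fst (nest Q n)) /\
                        fst (snd (nest Q n)) <= snd (snd (nest Q n))).
{ induction n as [|n [IH1 IH2]]; [simpl; lra|].
  destruct (bisect_half _ IH1 IH2) as [[_ [_ H1]] [_ [_ H2]]].
  simpl; unfold nest in *; lra. }
destruct (nested_intervals (fun n => fst (nest Q n))) as [Ls [s0 Hs0]].
{ exact Hab. }
{ intros n _; destruct (Hle n); apply bisect_half; assumption. }
destruct (nested_intervals (fun n => snd (nest Q n))) as [Lt [t0 Ht0]].
{ exact Hcd. }
{ intros n _; destruct (Hle n); apply bisect_half; assumption. }
destruct (locally_closed s0 t0) as [l Hl].
apply Rle_antisym; [|assumption].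
apply le_epsilon; intros e He; rewrite Rplus_0_l.
(* At depth [n] the sides add up to at most [L / 2 ^ n], so the circulation is at most
   [eps * L * L / 4 ^ n]; the choice [eps = e / (L * L)] leaves [e] after multiplication by [4 ^ n].
   The summand 1 keeps [L] positive for a degenerate rectangle. *)
set (L := b - a + (d - c) + 1).
assert (HL : 1 <= L) by (unfold L; lra).
destruct (Hl (e / (L * L))) as [delta [Hd Hloc]].
{ apply Rdiv_lt_0_compat; nra. }
assert (Hsmall : exists n, L / 2 ^ n < delta).
{ destruct (pow_lt_1_zero (1/2)) with (y := delta / L) as [n Hn].
  - rewrite Rabs_pos_eq; lra.
  - apply Rdiv_lt_0_compat; lra.
  - exists n. specialize (Hn n (le_n n)).
    rewrite Rabs_pos_eq in Hn; [|apply pow_le; lra].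
    unfold Rdiv in Hn; rewrite Rmult_1_l pow_inv in Hn.
    apply (Rmult_lt_compat_l L) in Hn; [|lra].
    unfold Rdiv; replace delta with (L * (delta * / L)) by (field; lra).
    exact Hn. }
destruct Hsmall as [n Hn].
apply Rle_trans with (1 := nest_ge Q n).
specialize (Ls n); specialize (Lt n); specialize (Hs0 n); specialize (Ht0 n).
destruct (Hle n) as [Hl1 Hl2]; simpl in Ls, Lt, Hs0, Ht0.
destruct (nest Q n) as [[a' b'] [c' d']]; simpl in *.
assert (Hp : 0 < 2 ^ n) by (apply pow_lt; lra).
assert (Hi : 0 < / 2 ^ n) by now apply Rinv_0_lt_compat.
unfold Rdiv in Ls, Lt, Hn.
assert (Hsum : b' - a' + (d' - c') <= L * / 2 ^ n) by (rewrite Ls Lt; unfold L; nra).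
assert (HM : norm (circulation a' b' c' d') <=
  (d' - c' + (b' - a')) * (e / (L * L) * (b' - a' + (d' - c')))).
{ apply circulation_estimate with (l := l); try assumption; intros.

  - apply (Hloc a' b' c' d' s0 t); lra.
  - apply (Hloc a' b' c' d' s t0); lra. }
assert (Heq : 4 ^ n = 2 ^ n * 2 ^ n).
{ rewrite -Rpow_mult_distr; f_equal; lra. }
apply Rle_trans with (4 ^ n * ((L * / 2 ^ n) * (e / (L * L) * (L * / 2 ^ n)))).
- apply Rmult_le_compat_l; [rewrite Heq; nra|].
  apply Rle_trans with (1 := HM).
  assert (0 <= e / (L * L)) by (apply Rlt_le, Rdiv_lt_0_compat; nra).
  apply Rmult_le_compat; [lra| |lra|].
  + apply Rmult_le_pos; lra.
  + apply Rmult_le_compat_l; lra.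
- rewrite Heq; apply Req_le; field; lra.
Qed.

End Circulation.

(** * Differentiable functions of two real variables *)

Notation C_abs := (AbsRing_UniformSpace C_AbsRing).

Lemma continuous_C_abs {U : UniformSpace} (f : U -> C) (x : U) :
  continuous (U := C_abs) (f : U -> C_abs) x <->
  forall eps : posreal, locally x (fun y => Cmod (f y - f x) < eps).
Proof. exact (filterlim_locally (U := C_abs) f (f x)). Qed.

(** [C] carries two uniform structures with the same topology: boxes, used by the integral, and
    discs of the modulus, used by the ring operations and by all estimates. *)
Lemma continuous_C_of_abs {U : UniformSpace} (f : U -> C) (x : U) :
  continuous (U := C_abs) (f : U -> C_abs) x ->
  continuous (U := C_UniformSpace) (f : U -> C_UniformSpace) x.
Proof. intros Hf P HP; apply Hf; now apply locally_C. Qed.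

Lemma continuous_RtoC_comp {U : UniformSpace} (f : U -> R) (x : U) :
  continuous f x -> continuous (U := C_abs) (fun y => RtoC (f y) : C_abs) x.
Proof.
intros Hf; apply continuous_C_abs; intros eps.
generalize (proj1 (filterlim_locally (U := R_UniformSpace) f (f x)) Hf eps).
apply filter_imp; intros y Hy.
now rewrite -RtoC_minus Cmod_R.
Qed.

Lemma continuous_Cplus {U : UniformSpace} (f g : U -> C) (x : U) :
  continuous (U := C_abs) f x -> continuous (U := C_abs) g x ->
  continuous (U := C_abs) (fun y => (f y + g y)%C : C_abs) x.
Proof. exact (continuous_plus (V := AbsRing_NormedModule C_AbsRing) f g x). Qed.

Lemma continuous_Cmult {U : UniformSpace} (f g : U -> C) (x : U) :
  continuous (U := C_abs) f x -> continuous (U := C_abs) g x ->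
  continuous (U := C_abs) (fun y => (f y * g y)%C : C_abs) x.
Proof. exact (continuous_mult (K := C_AbsRing) f g x). Qed.

Lemma continuous_Cinv (z : C) : z <> 0%C -> continuous (U := C_abs) (Cinv : C_abs -> C_abs) z.
Proof.
intros Hz; apply continuous_C_abs; intros eps.
assert (Hm := proj1 (Cmod_gt_0 z) Hz).
(* The first bound keeps [Cmod y] above [Cmod z / 2]; with it, the second makes [Cmod (y - z)]
   smaller than [eps * Cmod y * Cmod z]. *)
assert (Hd : 0 < Rmin (Cmod z / 2) (eps * (Cmod z * Cmod z / 2))).
{ apply Rmin_pos; [lra|]. apply Rmult_lt_0_compat; [apply eps|nra]. }
exists (mkposreal _ Hd); intros y Hy.
change (Cmod (y - z) < Rmin (Cmod z / 2) (eps * (Cmod z * Cmod z / 2))) in Hy.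
assert (Hy1 := Rlt_le_trans _ _ _ Hy (Rmin_l _ _)).
assert (Hy2 := Rlt_le_trans _ _ _ Hy (Rmin_r _ _)).
assert (Hym : Cmod z / 2 < Cmod y).
{ assert (H := Cmod_triangle (z - y) y). replace (z - y + y)%C with z in H by ring.
  rewrite -(Cmod_opp (z - y)) in H. replace (- (z - y))%C with (y - z)%C in H by ring. lra. }
assert (Hy0 : y <> RtoC 0 :> C).
{ intros ->; rewrite Cmod_0 in Hym; lra. }
replace (/ y - / z)%C with (- ((y - z) / (y * z)))%C by now field.
rewrite Cmod_opp Cmod_div ?Cmod_mult; [|now apply Cmult_neq_0].
apply (Rmult_lt_reg_r (Cmod y * Cmod z)); [nra|].
unfold Rdiv; rewrite Rmult_assoc Rinv_l; [|nra].
rewrite Rmult_1_r; apply Rlt_le_trans with (1 := Hy2).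
apply Rmult_le_compat_l; [apply Rlt_le, eps|nra].
Qed.

(* Caratheodory's form of differentiability: the slopes are functions continuous at the point. *)
Definition diff2 (F : R -> R -> C) (s0 t0 : R) (A B : C) : Prop :=
  exists al be : R * R -> C,
    continuous (U := C_abs) al (s0, t0) /\ continuous (U := C_abs) be (s0, t0) /\
    al (s0, t0) = A /\ be (s0, t0) = B /\
    forall s t, (F s t - F s0 t0 = al (s, t) * (s - s0)%R + be (s, t) * (t - t0)%R)%C.

Lemma diff2_continuous (F : R -> R -> C) s0 t0 A B :
  diff2 F s0 t0 A B -> continuous (U := C_abs) (fun p : R * R => F (fst p) (snd p)) (s0, t0).
Proof.
intros (al & be & Ha & Hb & _ & _ & HF).
refine (continuous_ext (T := prod_UniformSpace R_UniformSpace R_UniformSpace) (U := C_abs) (fun p :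
  R * R => (F s0 t0 +
  (al p * (fst p - s0)%R + be p * (snd p - t0)%R))%C) _ _ _ _).
{ intros [s t]; simpl; rewrite -HF; ring. }
apply continuous_Cplus; [apply (continuous_const (V := C_abs))|].
apply continuous_Cplus; apply continuous_Cmult; try assumption;
apply (continuous_RtoC_comp (U := prod_UniformSpace R_UniformSpace R_UniformSpace));
apply (continuous_minus (V := R_NormedModule));
solve [apply continuous_const | apply continuous_fst | apply continuous_snd].
Qed.

Lemma diff2_const (z : C) s0 t0 : diff2 (fun _ _ => z) s0 t0 0 0.
Proof.
exists (fun _ => 0%C), (fun _ => 0%C); repeat split; try apply (continuous_const (V := C_abs)).
intros s t; ring.
Qed.

(** The value [l] at the point itself makes the difference quotient continuous there, as
    Caratheodory's form requires. *)
Definition slope (u : R -> R) (x l y : R) : R :=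
  if Req_EM_T y x is left _ then l else (u y - u x) / (y - x).

Lemma slope_eq u x l y : u y - u x = slope u x l y * (y - x).
Proof.
unfold slope; destruct Req_EM_T as [->|H]; [ring|field; lra].
Qed.

Lemma slope_continuous u x l : is_derive u x l -> continuous (slope u x l) x.
Proof.
intros Hu; apply (filterlim_locally (U := R_UniformSpace)); intros eps.
destruct (proj1 (is_derive_Reals u x l) Hu eps (cond_pos eps)) as [d Hd].
exists d; intros y Hy.
change (Rabs (y - x) < d) in Hy; change (Rabs (slope u x l y - slope u x l x) < eps).
unfold slope; destruct (Req_EM_T x x); [|easy].
destruct (Req_EM_T y x) as [->|H].
- rewrite Rminus_diag Rabs_R0; apply eps.
- specialize (Hd (y - x) ltac:(lra) Hy).
  assert (E : forall a b : R, a + (b - a) = b) by (intros; ring).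
  now rewrite E in Hd.
Qed.

Lemma diff2_fst u s0 t0 l :
  is_derive u s0 l -> diff2 (fun s _ => RtoC (u s)) s0 t0 (RtoC l) 0.
Proof.
intros Hu; exists (fun p => RtoC (slope u s0 l (fst p))), (fun _ => 0%C); repeat split.
- apply (continuous_RtoC_comp (U := prod_UniformSpace R_UniformSpace R_UniformSpace)).
  apply (continuous_comp (U := prod_UniformSpace R_UniformSpace R_UniformSpace) fst).
  + apply continuous_fst.
  + now apply slope_continuous.
- apply (continuous_const (V := C_abs)).
- simpl; unfold slope; now destruct Req_EM_T.
- intros s t; simpl; rewrite -RtoC_minus (slope_eq u s0 l s) RtoC_mult; ring.
Qed.

Lemma diff2_snd u s0 t0 l :
  is_derive u t0 l -> diff2 (fun _ t => RtoC (u t)) s0 t0 0 (RtoC l).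
Proof.
intros Hu; exists (fun _ => 0%C), (fun p => RtoC (slope u t0 l (snd p))); repeat split.
- apply (continuous_const (V := C_abs)).
- apply (continuous_RtoC_comp (U := prod_UniformSpace R_UniformSpace R_UniformSpace)).
  apply (continuous_comp (U := prod_UniformSpace R_UniformSpace R_UniformSpace) snd).
  + apply continuous_snd.
  + now apply slope_continuous.
- simpl; unfold slope; now destruct Req_EM_T.
- intros s t; simpl; rewrite -RtoC_minus (slope_eq u t0 l t) RtoC_mult; ring.
Qed.

Lemma diff2_plus (F G : R -> R -> C) s0 t0 A B A' B' :
  diff2 F s0 t0 A B -> diff2 G s0 t0 A' B' ->
  diff2 (fun s t => F s t + G s t)%C s0 t0 (A + A') (B + B').
Proof.
intros (a & b & Ca & Cb & <- & <- & HF) (a' & b' & Ca' & Cb' & <- & <- & HG).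
exists (fun p => a p + a' p)%C, (fun p => b p + b' p)%C; repeat split;
  try (now apply continuous_Cplus).
intros s t.
transitivity ((F s t - F s0 t0) + (G s t - G s0 t0))%C; [ring|].
rewrite HF HG; ring.
Qed.

Lemma diff2_mult (F G : R -> R -> C) s0 t0 A B A' B' :
  diff2 F s0 t0 A B -> diff2 G s0 t0 A' B' ->
  diff2 (fun s t => F s t * G s t)%C s0 t0 (A * G s0 t0 + F s0 t0 * A')
    (B * G s0 t0 + F s0 t0 * B').
Proof.
intros HF' (a' & b' & Ca' & Cb' & <- & <- & HG).
assert (CF := diff2_continuous _ _ _ _ _ HF').
destruct HF' as (a & b & Ca & Cb & <- & <- & HF).
exists (fun p => a p * G s0 t0 + F (fst p) (snd p) * a' p)%C,
       (fun p => b p * G s0 t0 + F (fst p) (snd p) * b' p)%C; repeat split.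
- apply continuous_Cplus; apply continuous_Cmult; try assumption;
  apply (continuous_const (V := C_abs)).
- apply continuous_Cplus; apply continuous_Cmult; try assumption;
  apply (continuous_const (V := C_abs)).
- intros s t; simpl.
  transitivity ((F s t - F s0 t0) * G s0 t0 + F s t * (G s t - G s0 t0))%C; [ring|].
  rewrite HF HG; ring.
Qed.

Lemma diff2_inv (F : R -> R -> C) s0 t0 A B :
  (forall s t, F s t <> 0%C) -> diff2 F s0 t0 A B ->
  diff2 (fun s t => / F s t)%C s0 t0 (- A / (F s0 t0 * F s0 t0)) (- B / (F s0 t0 * F s0 t0)).
Proof.
intros H0 HF'.
assert (CF := diff2_continuous _ _ _ _ _ HF').
destruct HF' as (a & b & Ca & Cb & <- & <- & HF).
assert (Ci : continuous (U := C_abs) (fun p : R * R => (- / F s0 t0 * / F (fst p) (snd p))%C :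
  C_abs) (s0, t0)).
{ apply continuous_Cmult; [apply (continuous_const (V := C_abs))|].
  apply (continuous_comp (V := C_abs) (W := C_abs) (fun p : R * R => F (fst p) (snd p)) Cinv);
  [assumption|].
  apply continuous_Cinv, H0. }
exists (fun p => a p * (- / F s0 t0 * / F (fst p) (snd p)))%C,
       (fun p => b p * (- / F s0 t0 * / F (fst p) (snd p)))%C; repeat split;
  try (now apply continuous_Cmult); simpl.
- field; apply H0.
- field; apply H0.
- intros s t.
  transitivity (- (F s t - F s0 t0) / (F s0 t0 * F s t))%C; [field; auto|].
  rewrite HF; field; auto.
Qed.

Lemma Cminus_eq_0 (y z : C) : (y - z = 0)%C -> y = z.
Proof. intros E; replace y with (y - z + z)%C by ring; rewrite E; ring. Qed.

(** An epsilon form in terms of the modulus, independent of which normed structure on [C] a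
    derivative refers to. *)
Definition C_diff (f : C -> C) (z l : C) : Prop :=
  forall eps, 0 < eps -> exists delta, 0 < delta /\ forall y, Cmod (y - z) < delta ->
    Cmod (f y - f z - l * (y - z)) <= eps * Cmod (y - z).

Definition C_slope (f : C -> C) (z l y : C) : C :=
  if excluded_middle_informative (y = z) is left _ then l else ((f y - f z) / (y - z))%C.

Lemma C_slope_eq f z l y : (f y - f z = C_slope f z l y * (y - z))%C.
Proof.
unfold C_slope; destruct excluded_middle_informative as [->|H]; [ring|field].
intros E; apply H; now apply Cminus_eq_0.
Qed.

Lemma C_slope_continuous f z l :
  C_diff f z l -> continuous (U := C_abs) (C_slope f z l : C_abs -> C_abs) z.
Proof.
intros Hf; apply continuous_C_abs; intros eps.
destruct (Hf (eps / 2)) as [d [Hd H]]; [destruct eps; simpl; lra|].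
exists (mkposreal d Hd); intros y Hy; change (Cmod (y - z) < d) in Hy.
assert (E : C_slope f z l z = l) by (unfold C_slope; now destruct excluded_middle_informative).
rewrite E; specialize (H y Hy); rewrite (C_slope_eq f z l) in H.
replace (C_slope f z l y * (y - z) - l * (y - z))%C with ((C_slope f z l y - l) * (y - z))%C in H
  by ring.
rewrite Cmod_mult in H.
destruct (excluded_middle_informative (y = z)) as [->|Hn].
- rewrite E. replace (l - l)%C with (RtoC 0) by ring. rewrite Cmod_0; apply eps.
- assert (0 < Cmod (y - z)).
  { apply Cmod_gt_0; intros E'; apply Hn; now apply Cminus_eq_0. }
  apply Rmult_le_reg_r in H; [|assumption]. destruct eps as [e He]; simpl in *; lra.
Qed.

Lemma diff2_comp f (F : R -> R -> C) s0 t0 A B l :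
  C_diff f (F s0 t0) l -> diff2 F s0 t0 A B ->
  diff2 (fun s t => f (F s t)) s0 t0 (l * A) (l * B).
Proof.
intros Hf HF'.
assert (CF := diff2_continuous _ _ _ _ _ HF').
destruct HF' as (a & b & Ca & Cb & <- & <- & HF).
assert (Cs : continuous (U := C_abs) (fun p : R * R => C_slope f (F s0 t0) l (F (fst p) (snd p)) :
  C_abs) (s0, t0)).
{ apply (continuous_comp (V := C_abs) (W := C_abs) (fun p : R * R => F (fst p) (snd p)) (C_slope f
    (F s0 t0) l)); [assumption|].
  now apply C_slope_continuous. }
exists (fun p => C_slope f (F s0 t0) l (F (fst p) (snd p)) * a p)%C,
       (fun p => C_slope f (F s0 t0) l (F (fst p) (snd p)) * b p)%C; repeat split;
  try (now apply continuous_Cmult); simpl.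
- f_equal. unfold C_slope; now destruct excluded_middle_informative.
- f_equal. unfold C_slope; now destruct excluded_middle_informative.
- intros s t; rewrite (C_slope_eq f (F s0 t0) l) HF; ring.
Qed.

Lemma diff2_estimate (F : R -> R -> C) s0 t0 A B :
  diff2 F s0 t0 A B -> forall eps, 0 < eps -> exists delta, 0 < delta /\
  forall s t, Rabs (s - s0) < delta -> Rabs (t - t0) < delta ->
    Cmod (F s t - F s0 t0 - (A * (s - s0)%R + B * (t - t0)%R)) <=
      eps * (Rabs (s - s0) + Rabs (t - t0)).
Proof.
intros (a & b & Ca & Cb & <- & <- & HF) eps Heps.
destruct (proj1 (continuous_C_abs _ _) Ca (mkposreal _ Heps)) as [d1 H1].
destruct (proj1 (continuous_C_abs _ _) Cb (mkposreal _ Heps)) as [d2 H2].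
exists (Rmin d1 d2); split; [apply Rmin_pos; apply cond_pos|].
intros s t Hs Ht.
assert (Ha : Cmod (a (s, t) - a (s0, t0)) < eps).
{ apply H1; split; [apply Rlt_le_trans with (1 := Hs)|apply Rlt_le_trans with (1 := Ht)];
  apply Rmin_l. }
assert (Hb : Cmod (b (s, t) - b (s0, t0)) < eps).
{ apply H2; split; [apply Rlt_le_trans with (1 := Hs)|apply Rlt_le_trans with (1 := Ht)];
  apply Rmin_r. }
rewrite HF.
match goal with |- Cmod ?x <= _ => replace x with ((a (s, t) - a (s0, t0)) * (s - s0)%R +
  (b (s, t) - b (s0, t0)) * (t - t0)%R)%C by ring end.
apply Rle_trans with (1 := Cmod_triangle _ _).
rewrite !Cmod_mult !Cmod_R.
assert (Hs0 := Rabs_pos (s - s0)); assert (Ht0 := Rabs_pos (t - t0)).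
nra.
Qed.

(** * Cauchy's theorem on circles *)

Lemma norm_C_R (z : C) : norm (V := C_R_NormedModule) z = Cmod z.
Proof. symmetry; apply Cmod_norm. Qed.

Lemma scal_C_R (x : R) (z : C) : scal (V := C_R_ModuleSpace) x z = (x * z)%C.
Proof. apply scal_R_Cmult. Qed.

(** The shared [k2] is the closedness of [k ds + g dt]: it is both the [t]-derivative of [k] and the
    [s]-derivative of [g]. *)
Lemma goursat_C (k g : R -> R -> C) :
  (forall s0 t0, exists k1 k2 g2 : C, diff2 k s0 t0 k1 k2 /\ diff2 g s0 t0 k2 g2) ->
  forall a b c d, a <= b -> c <= d ->
    circulation (V := C_R_CompleteNormedModule) k g a b c d = RtoC 0 :> C.
Proof.
intros Hdiff a b c d Hab Hcd.
apply (goursat (V := C_R_CompleteNormedModule)); try assumption.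
- intros s t; destruct (Hdiff s t) as (k1 & k2 & g2 & Hk & _).
  apply diff2_continuous in Hk.
  apply continuous_C_of_abs.
  apply (continuous_comp (V := prod_UniformSpace R_UniformSpace R_UniformSpace) (W := C_abs)
    (fun s => (s, t)) (fun p => k (fst p) (snd p))); [|exact Hk].
  intros P [e He]; exists e; intros y Hy; apply He; split; [exact Hy|apply ball_center].
- intros s t; destruct (Hdiff s t) as (k1 & k2 & g2 & _ & Hg).
  apply diff2_continuous in Hg.
  apply continuous_C_of_abs.
  apply (continuous_comp (V := prod_UniformSpace R_UniformSpace R_UniformSpace) (W := C_abs)
    (fun t => (s, t)) (fun p => g (fst p) (snd p))); [|exact Hg].
  intros P [e He]; exists e; intros y Hy; apply He; split; [apply ball_center|exact Hy].
- clear a b c d Hab Hcd; intros s0 t0.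
  destruct (Hdiff s0 t0) as (k1 & k2 & g2 & Hk & Hg); exists k2; intros eps Heps.
  (* An increment across the rectangle is a difference of two first-order expansions at [(s0, t0)],
     whence the halves; the term in the variable that stays fixed cancels. *)
  destruct (diff2_estimate _ _ _ _ _ Hk (eps / 2)) as [d1 [Hd1 H1]]; [lra|].
  destruct (diff2_estimate _ _ _ _ _ Hg (eps / 2)) as [d2 [Hd2 H2]]; [lra|].
  exists (Rmin d1 d2); split; [now apply Rmin_pos|].
  intros a b c d s t Hs0 Ht0 Hb Hd Hs Ht.
  assert (Hm1 := Rmin_l d1 d2); assert (Hm2 := Rmin_r d1 d2).
  assert (Es : forall x, a <= x <= b -> Rabs (x - s0) <= b - a) by (intros x Hx; apply Rabs_le;
  lra).
  assert (Et : forall x, c <= x <= d -> Rabs (x - t0) <= d - c) by (intros x Hx; apply Rabs_le;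
  lra).
  rewrite !norm_C_R !scal_C_R; split.
  + assert (Ga := H2 a t). assert (Gb := H2 b t).
    specialize (Ga ltac:(specialize (Es a); lra) ltac:(specialize (Et t); lra)).
    specialize (Gb ltac:(specialize (Es b); lra) ltac:(specialize (Et t); lra)).
    match goal with |- Cmod ?x <= _ =>
      replace x with ((g b t - g s0 t0 - (k2 * (b - s0)%R + g2 * (t - t0)%R)) +
        - (g a t - g s0 t0 - (k2 * (a - s0)%R + g2 * (t - t0)%R)))%C end.
    2: { repeat change (minus ?x ?y) with (x - y)%C; rewrite !RtoC_minus; ring. }
    apply Rle_trans with (1 := Cmod_triangle _ _); rewrite Cmod_opp.
    specialize (Es a) as Ea; specialize (Es b) as Eb; specialize (Et t Ht). nra.
  + assert (Ga := H1 s c). assert (Gb := H1 s d).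
    specialize (Ga ltac:(specialize (Es s); lra) ltac:(specialize (Et c); lra)).
    specialize (Gb ltac:(specialize (Es s); lra) ltac:(specialize (Et d); lra)).
    match goal with |- Cmod ?x <= _ =>
      replace x with ((k s d - k s0 t0 - (k1 * (s - s0)%R + k2 * (d - t0)%R)) +
        - (k s c - k s0 t0 - (k1 * (s - s0)%R + k2 * (c - t0)%R)))%C end.
    2: { repeat change (minus ?x ?y) with (x - y)%C; rewrite !RtoC_minus; ring. }
    apply Rle_trans with (1 := Cmod_triangle _ _); rewrite Cmod_opp.
    specialize (Et c) as Ea; specialize (Et d) as Eb; specialize (Es s Hs). nra.
Qed.

Definition cis (t : R) : C := (cos t, sin t).

Lemma cisE t : cis t = (cos t + Ci * sin t)%C.
Proof. unfold cis, Ci, RtoC, Cplus, Cmult; simpl; f_equal; ring. Qed.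

Lemma Cmod_cis t : Cmod (cis t) = 1.
Proof.
unfold Cmod, cis; simpl.
replace (cos t * (cos t * 1) + sin t * (sin t * 1)) with (Rsqr (sin t) + Rsqr (cos t)) by (unfold
  Rsqr; ring).
rewrite sin2_cos2; apply sqrt_1.
Qed.

Lemma cis_plus x y : cis (x + y) = (cis x * cis y)%C.
Proof. unfold cis, Cmult; simpl; rewrite cos_plus sin_plus; f_equal; ring. Qed.

Lemma cis_0 : cis 0 = 1%C.
Proof. unfold cis; now rewrite cos_0 sin_0. Qed.

Lemma diff2_eq (F G : R -> R -> C) s0 t0 A B A' B' :
  (forall s t, F s t = G s t) -> A = A' -> B = B' -> diff2 F s0 t0 A B -> diff2 G s0 t0 A' B'.
Proof.
intros E <- <-.
replace G with F; [easy|].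
now apply functional_extensionality; intros s; apply functional_extensionality; intros t.
Qed.

Lemma diff2_cis s0 t0 : diff2 (fun _ t => cis t) s0 t0 0 (Ci * cis t0).
Proof.
assert (Hc : is_derive cos t0 (- sin t0)) by (apply is_derive_Reals, derivable_pt_lim_cos).
assert (Hs : is_derive sin t0 (cos t0)) by (apply is_derive_Reals, derivable_pt_lim_sin).
refine (diff2_eq _ _ _ _ _ _ _ _ _ _ _ (diff2_plus _ _ _ _ _ _ _ _ (diff2_snd cos s0 t0 _ Hc)
  (diff2_mult _ _ _ _ _ _ _ _ (diff2_const Ci s0 t0) (diff2_snd sin s0 t0 _ Hs)))).
- intros _ t; now rewrite cisE.
- ring.
- unfold cis, Ci, RtoC, Cplus, Cmult; simpl; f_equal; ring.
Qed.

Section Cauchy.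

Variable f : C -> C.
Hypothesis f_diff : forall z, exists l, C_diff f z l.
Variables (r : R) (w : C).
Hypothesis w_small : Cmod w < r.

Lemma radius_pos : 0 < r.
Proof. assert (H := Cmod_ge_0 w); lra. Qed.

Definition arm (t : R) : C := (r * cis t - w)%C.

Lemma Cmod_circle t : Cmod (r * cis t)%C = r.
Proof. rewrite Cmod_mult Cmod_cis Cmod_R Rabs_pos_eq; assert (H := radius_pos); lra. Qed.

Lemma Cmod_arm_ge t : r - Cmod w <= Cmod (arm t).
Proof.
assert (H := Cmod_triangle (arm t) w); unfold arm in *.
replace (r * cis t - w + w)%C with (r * cis t)%C in H by ring.
rewrite Cmod_circle in H; lra.
Qed.

Lemma Cmod_arm_le t : Cmod (arm t) <= 2 * r.
Proof.
assert (H := Cmod_triangle (r * cis t) (- w)); unfold arm.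
rewrite Cmod_circle Cmod_opp in H; unfold Cminus; lra.
Qed.

Lemma arm_neq_0 t : arm t <> 0%C.
Proof. apply Cmod_gt_0; assert (H := Cmod_arm_ge t); lra. Qed.

(** The circle at [s = 0], contracted homothetically onto [w] as [s] tends to minus infinity. The
    exponential makes [dz / (z - w)] pull back to [ds + kernel t dt], whose coefficients do not
    depend on [s]. *)
Definition cone (s t : R) : C := (w + exp s * arm t)%C.

(* [i z dt = dz] on the circle [z = r cis t], so [kernel t dt] is [dz / (z - w)]. *)
Definition kernel (t : R) : C := (Ci * (r * cis t) / arm t)%C.

Lemma Cmod_kernel_le t : Cmod (kernel t) <= r / (r - Cmod w).
Proof.
unfold kernel; rewrite Cmod_div; [|apply arm_neq_0].
rewrite Cmod_mult Cmod_Ci Cmod_circle Rmult_1_l.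
assert (H := radius_pos); assert (H' := Cmod_arm_ge t).
apply Rmult_le_compat_l; [lra|]; apply Rinv_le_contravar; lra.
Qed.

Lemma diff2_arm s0 t0 : diff2 (fun _ t => arm t) s0 t0 0 (Ci * (r * cis t0)).
Proof.
refine (diff2_eq _ _ _ _ _ _ _ _ _ _ _ (diff2_plus _ _ _ _ _ _ _ _
  (diff2_mult _ _ _ _ _ _ _ _ (diff2_const (RtoC r) s0 t0) (diff2_cis s0 t0)) (diff2_const (- w) s0
    t0))).
- reflexivity.
- ring.
- ring.
Qed.

Lemma diff2_cone s0 t0 :
  diff2 cone s0 t0 (exp s0 * arm t0) (exp s0 * (Ci * (r * cis t0))).
Proof.
assert (He : is_derive exp s0 (exp s0)) by (apply is_derive_Reals, derivable_pt_lim_exp).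
refine (diff2_eq _ _ _ _ _ _ _ _ _ _ _ (diff2_plus _ _ _ _ _ _ _ _ (diff2_const w s0 t0)
  (diff2_mult _ _ _ _ _ _ _ _ (diff2_fst exp s0 t0 _ He) (diff2_arm s0 t0)))).
- reflexivity.
- ring.
- ring.
Qed.

Lemma diff2_kernel s0 t0 : exists l, diff2 (fun _ t => kernel t) s0 t0 0 l.
Proof.
eexists.
refine (diff2_eq _ _ _ _ _ _ _ _ _ _ _ (diff2_mult _ _ _ _ _ _ _ _
  (diff2_mult _ _ _ _ _ _ _ _ (diff2_const (Ci * r) s0 t0) (diff2_cis s0 t0))
  (diff2_inv _ _ _ _ _ (fun _ => arm_neq_0) (diff2_arm s0 t0)))).
- intros _ t; unfold kernel, Cdiv; ring.
- unfold Cdiv; ring.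
- reflexivity.
Qed.

(** The product [arm t * kernel t] is the derivative of [arm], so both mixed derivatives equal
    [l * exp s * (Ci * (r * cis t))], where [l] is the derivative of [f] at the point. *)
Lemma cone_closed s0 t0 : exists k1 k2 g2 : C,
  diff2 (fun s t => f (cone s t)) s0 t0 k1 k2 /\
  diff2 (fun s t => f (cone s t) * kernel t)%C s0 t0 k2 g2.
Proof.
destruct (f_diff (cone s0 t0)) as [l Hl].
assert (Hk := diff2_comp f _ s0 t0 _ _ l Hl (diff2_cone s0 t0)).
destruct (diff2_kernel s0 t0) as [m Hm].
do 3 eexists; split; [exact Hk|].
refine (diff2_eq _ _ _ _ _ _ _ _ _ _ _ (diff2_mult _ _ _ _ _ _ _ _ Hk Hm)).
- reflexivity.
- unfold kernel; field; apply arm_neq_0.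
- reflexivity.
Qed.

Lemma continuous_circle_kernel s t :
  continuous (U := C_UniformSpace) (fun t => f (cone s t) * kernel t)%C t.
Proof.
destruct (cone_closed s t) as (k1 & k2 & g2 & _ & Hg).
apply diff2_continuous in Hg.
apply continuous_C_of_abs.
apply (continuous_comp (V := prod_UniformSpace R_UniformSpace R_UniformSpace) (W := C_abs)
  (fun t => (s, t)) (fun p => (f (cone (fst p) (snd p)) * kernel (snd p))%C)); [|exact Hg].
intros P [e He]; exists e; intros y Hy; apply He; split; [apply ball_center|exact Hy].
Qed.

Definition cone_integral (s : R) : C :=
  RInt (V := C_R_CompleteNormedModule) (fun t => f (cone s t) * kernel t)%C 0 (2 * PI).

Lemma is_RInt_cone s :
  is_RInt (V := C_R_NormedModule) (fun t => f (cone s t) * kernel t)%C 0 (2 * PI) (cone_integral s).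
Proof.
apply (RInt_correct (V := C_R_CompleteNormedModule)).
apply (ex_RInt_continuous (V := C_R_CompleteNormedModule)); intros t _.
apply continuous_circle_kernel.
Qed.

Lemma cone_periodic s : cone s (2 * PI) = cone s 0.
Proof.
unfold cone, arm; replace (cis (2 * PI)) with (cis 0); [reflexivity|].
unfold cis; now rewrite cos_2PI sin_2PI cos_0 sin_0.
Qed.

(** On the rectangle between [s] and 0, the sides [t = 0] and [t = 2 * PI] carry the same values and
    cancel; the integrals over the two closed curves remain. *)
Lemma cone_integral_constant s : s <= 0 -> cone_integral s = cone_integral 0.
Proof.
intros Hs.
assert (HPI := PI_RGT_0).
assert (H := goursat_C _ _ cone_closed s 0 0 (2 * PI) Hs ltac:(lra)).
unfold circulation in H.
rewrite (RInt_ext (V := C_R_CompleteNormedModule) (fun s => minus (f (cone s (2 * PI))) (f (cone s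
  0))) (fun _ => zero)) in H.
2: { intros x _; cbv beta; rewrite cone_periodic; apply (minus_eq_zero (G := C_AbelianGroup)). }
rewrite (is_RInt_unique (V := C_R_CompleteNormedModule) _ _ _ _
  (is_RInt_minus (V := C_R_NormedModule) _ _ _ _ _ _ (is_RInt_cone 0) (is_RInt_cone s))) in H.
rewrite (RInt_const (V := C_R_CompleteNormedModule)) in H.
symmetry; apply Cminus_eq_0; rewrite -H.
rewrite (scal_zero_r (V := C_R_ModuleSpace)).
change (cone_integral 0 - cone_integral s = (cone_integral 0 - cone_integral s) - 0)%C; ring.
Qed.

(** On the curve contracted by a factor [x], a differentiable [f] vanishing at [w] is of order [x],
    while the kernel keeps its size. The integral does not depend on [x], hence it is zero. *)
Lemma cauchy_zero : f w = 0%C -> cone_integral 0 = 0%C.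
Proof.
intros Hw; apply Cmod_eq_0.
assert (HPI := PI_RGT_0); assert (Hr := radius_pos).
apply Rle_antisym; [|apply Cmod_ge_0].
apply le_epsilon; intros e He; rewrite Rplus_0_l.
destruct (f_diff w) as [l Hl].
destruct (Hl 1) as [d [Hd H]]; [lra|].
set (M := (Cmod l + 1) * (2 * r) * (r / (r - Cmod w)) * (2 * PI)).
assert (HM : 0 < M).
{ unfold M; assert (H0 := Cmod_ge_0 l).
  assert (0 < r / (r - Cmod w)) by (apply Rdiv_lt_0_compat; lra).
  apply Rmult_lt_0_compat; [apply Rmult_lt_0_compat; [apply Rmult_lt_0_compat|]|]; lra. }
(* The bound 1 gives [ln x <= 0]; the bound [d / (3 * r)] keeps the curve, within [2 * r * x] of
   [w], inside the disc of radius [d]; the last one makes the integral at most [e]. *)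
set (x := Rmin 1 (Rmin (d / (3 * r)) (e / M))).
assert (Hx : 0 < x).
{ unfold x; apply Rmin_pos; [lra|apply Rmin_pos; apply Rdiv_lt_0_compat; lra]. }
assert (Hx1 : x <= 1) by apply Rmin_l.
assert (Hx2 : x <= d / (3 * r)) by (apply Rle_trans with (1 := Rmin_r _ _); apply Rmin_l).
assert (Hx3 : x <= e / M) by (apply Rle_trans with (1 := Rmin_r _ _); apply Rmin_r).
assert (Hx2' : x * (3 * r) <= d).
{ apply (Rmult_le_compat_r (3 * r)) in Hx2; [|lra].
  replace (d / (3 * r) * (3 * r)) with d in Hx2 by (field; lra); lra. }
assert (Hx3' : x * M <= e).
{ apply (Rmult_le_compat_r M) in Hx3; [|lra].
  replace (e / M * M) with e in Hx3 by (field; lra); lra. }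
rewrite -(cone_integral_constant (ln x)).
2: { rewrite -ln_1; destruct (Req_dec x 1) as [->|]; [lra|apply Rlt_le, ln_increasing; lra]. }
apply Rle_trans with (2 := Hx3').
rewrite -norm_C_R.
replace (x * M) with ((2 * PI - 0) * (x * ((Cmod l + 1) * (2 * r) * (r / (r - Cmod w))))) by
  (unfold M; ring).
apply (norm_RInt_le_const (V := C_R_NormedModule)) with (3 := is_RInt_cone (ln x)); [lra|].
intros t _; rewrite norm_C_R Cmod_mult.
assert (Hc : (cone (ln x) t - w = x * arm t)%C) by (unfold cone; rewrite exp_ln; [ring|assumption]).
assert (Hcm : Cmod (cone (ln x) t - w) <= x * (2 * r)).
{ rewrite Hc Cmod_mult Cmod_R Rabs_pos_eq; [|lra].
  apply Rmult_le_compat_l; [lra|apply Cmod_arm_le]. }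
specialize (H (cone (ln x) t) ltac:(nra)).
assert (Hf : Cmod (f (cone (ln x) t)) <= (Cmod l + 1) * (x * (2 * r))).
{ rewrite Hw in H.
  replace (f (cone (ln x) t)) with ((f (cone (ln x) t) - 0 - l * (cone (ln x) t - w)) +
    l * (cone (ln x) t - w))%C by ring.
  apply Rle_trans with (1 := Cmod_triangle _ _); rewrite Cmod_mult.
  assert (H0 := Cmod_ge_0 l); nra. }
assert (HK := Cmod_kernel_le t).
assert (HK0 := Cmod_ge_0 (kernel t)); assert (Hf0 := Cmod_ge_0 (f (cone (ln x) t))).
apply Rle_trans with ((Cmod l + 1) * (x * (2 * r)) * (r / (r - Cmod w))).
- now apply Rmult_le_compat.
- apply Req_le; ring.
Qed.

Lemma cone_0 t : cone 0 t = (r * cis t)%C.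
Proof. unfold cone, arm; rewrite exp_0; ring. Qed.

End Cauchy.

(** * Integrals of negative powers along a circle *)

Lemma is_RInt_Cmult (c : C) (f : R -> C) a b (l : C) :
  is_RInt (V := C_R_NormedModule) f a b l ->
  is_RInt (V := C_R_NormedModule) (fun t => (c * f t)%C) a b (c * l)%C.
Proof.
intros H.
assert (H1 := is_RInt_fct_extend_fst (U := R_NormedModule) (V := R_NormedModule) f a b l H).
assert (H2 := is_RInt_fct_extend_snd (U := R_NormedModule) (V := R_NormedModule) f a b l H).
apply (is_RInt_fct_extend_pair (U := R_NormedModule) (V := R_NormedModule)); simpl.
- exact (is_RInt_minus _ _ _ _ _ _ (is_RInt_scal _ _ _ (fst c) _ H1) (is_RInt_scal _ _ _ (snd c) _
    H2)).
- exact (is_RInt_plus _ _ _ _ _ _ (is_RInt_scal _ _ _ (fst c) _ H2) (is_RInt_scal _ _ _ (snd c) _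
    H1)).
Qed.

Lemma C_diff_continuous f z l : C_diff f z l -> continuous (U := C_abs) (f : C_abs -> C_abs) z.
Proof.
intros Hf; apply continuous_C_abs; intros eps.
destruct (Hf 1) as [d [Hd H]]; [lra|].
assert (Hl := Cmod_ge_0 l).
assert (Hd' : 0 < Rmin d (eps / (Cmod l + 1))).
{ apply Rmin_pos; [assumption|apply Rdiv_lt_0_compat; [apply eps|lra]]. }
exists (mkposreal _ Hd'); intros y Hy.
change (Cmod (y - z) < Rmin d (eps / (Cmod l + 1))) in Hy.
assert (Hy1 := Rlt_le_trans _ _ _ Hy (Rmin_l _ _)).
assert (Hy2 := Rlt_le_trans _ _ _ Hy (Rmin_r _ _)).
specialize (H y Hy1).
assert (E : (f y - f z = (f y - f z - l * ((y : C) - z)) + l * ((y : C) - z))%C).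
{ generalize (y : C); intros u; ring. }
rewrite E; apply Rle_lt_trans with (1 := Cmod_triangle _ _); rewrite Cmod_mult.
apply (Rmult_lt_compat_r (Cmod l + 1)) in Hy2; [|lra].
replace (eps / (Cmod l + 1) * (Cmod l + 1)) with (pos eps) in Hy2 by (field; lra).
lra.
Qed.

Lemma continuous_cis (u : R -> R) t :
  continuous u t -> continuous (U := C_abs) (fun t => cis (u t) : C_abs) t.
Proof.
intros Hu.
apply (continuous_ext (T := R_UniformSpace) (U := C_abs) (fun t => (cos (u t) + Ci * sin (u t))%C)).
{ intros s; symmetry; apply cisE. }
apply continuous_Cplus; [|apply continuous_Cmult; [apply (continuous_const (V := C_abs))|]];
apply continuous_RtoC_comp; apply (continuous_comp u); try assumption;
apply (ex_derive_continuous (V := R_NormedModule)).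
- exists (- sin (u t)); apply is_derive_Reals, derivable_pt_lim_cos.
- exists (cos (u t)); apply is_derive_Reals, derivable_pt_lim_sin.
Qed.

Lemma is_RInt_C_continuous (f : R -> C) a b :
  (forall t, continuous (U := C_abs) (f : R -> C_abs) t) ->
  is_RInt (V := C_R_NormedModule) f a b (RInt (V := C_R_CompleteNormedModule) f a b).
Proof.
intros Hf; apply (RInt_correct (V := C_R_CompleteNormedModule)).
apply (ex_RInt_continuous (V := C_R_CompleteNormedModule)); intros t _.
now apply continuous_C_of_abs.
Qed.

(* [inv_pow r n t] is [z ^ (- n)] for [z = r cis t]. *)
Definition inv_pow (r : R) (n : nat) (t : R) : C := (RtoC (/ r ^ n) * cis (- (INR n * t)))%C.

Lemma inv_pow_S (r : R) n t : r <> 0 -> (inv_pow r (S n) t * (r * cis t) = inv_pow r n t)%C.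
Proof.
intros Hr; unfold inv_pow.
replace (- (INR n * t)) with (- (INR (S n) * t) + t) by (rewrite S_INR; ring).
rewrite cis_plus.
replace (RtoC (/ r ^ n)) with (RtoC (/ r ^ S n) * r)%C; [ring|].
rewrite -RtoC_mult; f_equal; simpl; field; split; [now apply pow_nonzero|assumption].
Qed.

Lemma Cmod_inv_pow r n t : 0 < r -> Cmod (inv_pow r n t) = / r ^ n.
Proof.
intros Hr; unfold inv_pow; rewrite Cmod_mult Cmod_cis Cmod_R Rmult_1_r.
apply Rabs_pos_eq, Rlt_le, Rinv_0_lt_compat; now apply pow_lt.
Qed.

Lemma continuous_inv_pow r n t : continuous (U := C_abs) (inv_pow r n : R -> C_abs) t.
Proof.
apply continuous_Cmult; [apply (continuous_const (V := C_abs))|].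
apply continuous_cis.
apply (continuous_opp (V := R_NormedModule)).
apply (continuous_scal_r (V := R_NormedModule)); apply continuous_id.
Qed.

(** For [n > 0] both components have periodic primitives. The exceptional case [n = 0] is the source
    of the factor [2 * PI] in front of [f w] below. *)
Lemma is_RInt_inv_pow r n :
  is_RInt (V := C_R_NormedModule) (inv_pow r n) 0 (2 * PI)
    (match n with O => RtoC (2 * PI) | S _ => RtoC 0 end).
Proof.
assert (HE : is_RInt (V := C_R_NormedModule) (fun t => (RtoC (/ r ^ n) * cis (- (INR n * t)))%C) 0
  (2 * PI)
  (RtoC (/ r ^ n) * match n with O => RtoC (2 * PI) | S _ => RtoC 0 end)%C).
{ apply is_RInt_Cmult; destruct n as [|n].
  - apply (is_RInt_ext (V := C_R_NormedModule)) with (fun _ => RtoC 1).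
    { intros t _; simpl; now rewrite Rmult_0_l Ropp_0 cis_0. }
    replace (RtoC (2 * PI)) with (scal (V := C_R_ModuleSpace) (2 * PI - 0) (RtoC 1)).
    + apply (is_RInt_const (V := C_R_NormedModule)).
    + rewrite scal_C_R -RtoC_mult; f_equal; ring.
  - assert (Hn : INR (S n) <> 0) by (apply not_0_INR; lia).
    set (N := INR (S n)) in *.
    apply (is_RInt_fct_extend_pair (U := R_NormedModule) (V := R_NormedModule)); simpl.
    + replace 0 with (minus (- sin (- (N * (2 * PI))) / N) (- sin (- (N * 0)) / N)) at 2.
      * apply (is_RInt_derive (fun t => - sin (- (N * t)) / N)).
        -- intros t _; auto_derive; [easy|field; assumption].
        -- intros t _; apply (ex_derive_continuous (V := R_NormedModule)); auto_derive; easy.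
      * replace (- (N * 0)) with 0 by ring; rewrite sin_0 sin_neg.
        replace (N * (2 * PI)) with (0 + 2 * N * PI) by ring.
        unfold N; rewrite sin_period sin_0.
        unfold minus, plus, opp; simpl; field; assumption.
    + replace 0 with (minus (cos (- (N * (2 * PI))) / N) (cos (- (N * 0)) / N)) at 2.
      * apply (is_RInt_derive (fun t => cos (- (N * t)) / N)).
        -- intros t _; auto_derive; [easy|field; assumption].
        -- intros t _; apply (ex_derive_continuous (V := R_NormedModule)); auto_derive; easy.
      * replace (- (N * 0)) with 0 by ring; rewrite cos_0 cos_neg.
        replace (N * (2 * PI)) with (0 + 2 * N * PI) by ring.
        unfold N; rewrite cos_period cos_0.
        unfold minus, plus, opp; simpl; field; assumption. }
match type of HE with is_RInt _ _ _ ?x =>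
  match goal with |- is_RInt _ _ _ ?y => replace y with x end end; [exact HE|].
destruct n; [simpl; rewrite Rinv_1; ring|ring].
Qed.

(** * Taylor expansion at the origin *)

Section Taylor.

Variable f : C -> C.
Hypothesis f_diff : forall z, exists l, C_diff f z l.

Lemma continuous_on_circle (r t : R) : continuous (U := C_abs) (fun t => f (r * cis t)%C : C_abs) t.
Proof.
apply (continuous_comp (V := C_abs) (W := C_abs) (fun t => (r * cis t)%C) f).
- apply continuous_Cmult; [apply (continuous_const (V := C_abs))|].
  apply continuous_cis, continuous_id.
- destruct (f_diff (r * cis t)%C) as [l Hl]; exact (C_diff_continuous _ _ _ Hl).
Qed.

Definition circle_coef (r : R) (n : nat) : C :=
  RInt (V := C_R_CompleteNormedModule) (fun t => f (r * cis t) * inv_pow r n t)%C 0 (2 * PI).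

Lemma is_RInt_circle_coef (r : R) n :
  is_RInt (V := C_R_NormedModule) (fun t => f (r * cis t) * inv_pow r n t)%C 0 (2 * PI)
    (circle_coef r n).
Proof.
apply is_RInt_C_continuous; intros t; apply continuous_Cmult.
- apply continuous_on_circle.
- apply continuous_inv_pow.
Qed.

Variables (r : R) (w : C).
Hypothesis w_small : Cmod w < r.

(** With [z = r cis t] this is [(f z - f w) (w / z)^n z / (z - w)]: what is left of Cauchy's
    integrand, written against [dt], after [n] terms of the geometric series in [w / z]. *)
Definition remainder (n : nat) (t : R) : C :=
  ((f (r * cis t) - f w) * (Cpow w n * (inv_pow r n t * (r * cis t / arm r w t))))%C.

(** One step of the geometric series: [z / (z - w) = 1 + (w / z) (z / (z - w))]. *)
Lemma remainder_S n t :
  (remainder n t = Cpow w n * (f (r * cis t) * inv_pow r n t) + 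
     (- (Cpow w n * f w)) * inv_pow r n t + remainder (S n) t)%C.
Proof.
assert (Hr := radius_pos r w w_small).
unfold remainder; rewrite -(inv_pow_S r n t); [|lra]; simpl.
assert (H := arm_neq_0 r w w_small t); unfold arm in *.
field; assumption.
Qed.

(** Cauchy's theorem for [f - f w], which vanishes at [w]; the factor [- Ci] turns [kernel] into
    [z / (z - w)]. *)
Lemma is_RInt_remainder_0 : is_RInt (V := C_R_NormedModule) (remainder 0) 0 (2 * PI) (RtoC 0).
Proof.
assert (Hd : forall z, exists l, C_diff (fun z => f z - f w)%C z l).
{ intros z; destruct (f_diff z) as [l Hl]; exists l; intros e He.
  destruct (Hl e He) as [d [Hd H]]; exists d; split; [assumption|]; intros y Hy.
  replace (f y - f w - (f z - f w) - l * (y - z))%C with (f y - f z - l * (y - z))%C by ring.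
  now apply H. }
assert (H := is_RInt_cone _ Hd r w w_small 0).
rewrite (cauchy_zero _ Hd r w w_small) in H; [|ring].
apply (is_RInt_Cmult (- Ci)) in H.
replace (RtoC 0) with (- Ci * RtoC 0)%C by ring.
apply (is_RInt_ext (V := C_R_NormedModule)) with (2 := H).
intros t _; unfold remainder, kernel, inv_pow.
rewrite cone_0; simpl.
rewrite Rmult_0_l Ropp_0 cis_0 Rinv_1.
transitivity (- (Ci * Ci) * ((f (r * cis t) - f w) * (r * cis t / arm r w t)))%C; [unfold Cdiv;
ring|].
replace (Ci * Ci)%C with (- RtoC 1)%C by (unfold Ci, RtoC, Cmult, Copp; simpl; f_equal; ring).
ring.
Qed.

Lemma is_RInt_remainder n :
  is_RInt (V := C_R_NormedModule) (remainder (S n)) 0 (2 * PI)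
    ((2 * PI)%R * f w - sum_n (G := C_AbelianMonoid) (fun k => Cpow w k * circle_coef r k) n)%C.
Proof.
induction n as [|n IH].
- assert (H := is_RInt_minus (V := C_R_NormedModule) _ _ _ _ _ _ is_RInt_remainder_0
   (is_RInt_plus (V := C_R_NormedModule) _ _ _ _ _ _
     (is_RInt_Cmult (Cpow w 0) _ _ _ _ (is_RInt_circle_coef r 0))
     (is_RInt_Cmult (- (Cpow w 0 * f w)) _ _ _ _ (is_RInt_inv_pow r 0)))).
  rewrite sum_O.
  match type of H with is_RInt _ _ _ ?x => replace ((2 * PI)%R * f w - Cpow w 0 * circle_coef r
    0)%C with x end.
  + apply (is_RInt_ext (V := C_R_NormedModule)) with (2 := H).
    intros t _.
    change (remainder 0 t - (Cpow w 0 * (f (r * cis t) * inv_pow r 0 t) + 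
      (- (Cpow w 0 * f w)) * inv_pow r 0 t) = remainder 1 t)%C.
    rewrite remainder_S; ring.
  + change (0 - (Cpow w 0 * circle_coef r 0 + - (Cpow w 0 * f w) * (2 * PI)%R) =
      (2 * PI)%R * f w - Cpow w 0 * circle_coef r 0)%C; simpl; ring.
- assert (H := is_RInt_minus (V := C_R_NormedModule) _ _ _ _ _ _ IH
   (is_RInt_plus (V := C_R_NormedModule) _ _ _ _ _ _
     (is_RInt_Cmult (Cpow w (S n)) _ _ _ _ (is_RInt_circle_coef r (S n)))
     (is_RInt_Cmult (- (Cpow w (S n) * f w)) _ _ _ _ (is_RInt_inv_pow r (S n))))).
  rewrite sum_Sn.
  match type of H with is_RInt _ _ _ ?x => match goal with |- is_RInt _ _ _ ?y => replace y with x
    end end.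
  + apply (is_RInt_ext (V := C_R_NormedModule)) with (2 := H).
    intros t _.
    change (remainder (S n) t - (Cpow w (S n) * (f (r * cis t) * inv_pow r (S n) t) + 
      (- (Cpow w (S n) * f w)) * inv_pow r (S n) t) = remainder (S (S n)) t)%C.
    rewrite (remainder_S (S n)); ring.
  + set (S := sum_n _ n).
    change (((2 * PI)%R * f w - S) - (Cpow w (Datatypes.S n) * circle_coef r (Datatypes.S n) + -
      (Cpow w (Datatypes.S n) * f w) * 0) =
      (2 * PI)%R * f w - (S + Cpow w (Datatypes.S n) * circle_coef r (Datatypes.S n)))%C; ring.
Qed.

Lemma remainder_bound : exists M, forall n,
  Cmod ((2 * PI)%R * f w - sum_n (G := C_AbelianMonoid) (fun k => Cpow w k * circle_coef r k)%C n)%C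
    <= M * (Cmod w / r) ^ S n.
Proof.
assert (Hr := radius_pos r w w_small); assert (HPI := PI_RGT_0).
destruct (bounded_continuity (V := C_R_NormedModule) (fun t => (f (r * cis t) - f w)%C) 0 (2 * PI))
  as [M HM].
{ intros t _; apply (continuous_C_of_abs (U := R_UniformSpace) (fun t => (f (r * cis t) - f w)%C)
    t).
  apply (continuous_Cplus (fun t => f (r * cis t)%C) (fun _ => (- f w)%C));
  [apply continuous_on_circle|apply (continuous_const (V := C_abs))]. }
exists (2 * PI * (M * (r / (r - Cmod w)))); intros n.
rewrite -norm_C_R.
replace (2 * PI * (M * (r / (r - Cmod w))) * (Cmod w / r) ^ S n) with
  ((2 * PI - 0) * (M * ((Cmod w / r) ^ S n * (r / (r - Cmod w))))) by ring.
apply (norm_RInt_le_const (V := C_R_NormedModule)) with (3 := is_RInt_remainder n); [lra|].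
intros t Ht; specialize (HM t Ht); rewrite norm_C_R in HM.
rewrite norm_C_R; unfold remainder;
rewrite Cmod_mult (Cmod_mult (Cpow w (S n))) (Cmod_mult (inv_pow r (S n) t)) Cmod_pow Cmod_inv_pow;
[|assumption].
assert (HK := Cmod_kernel_le r w w_small t).
assert (E : kernel r w t = (Ci * (r * cis t / arm r w t))%C) by (unfold kernel, Cdiv; ring).
rewrite E Cmod_mult Cmod_Ci Rmult_1_l in HK.
unfold Rdiv at 1; rewrite Rpow_mult_distr pow_inv.
rewrite (Rmult_assoc (Cmod w ^ S n)).
apply Rmult_le_compat; [apply Cmod_ge_0| |lra|].
- repeat apply Rmult_le_pos; try apply Cmod_ge_0; [apply pow_le, Cmod_ge_0|].
  apply Rlt_le, Rinv_0_lt_compat, pow_lt; assumption.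
- apply Rmult_le_compat_l; [apply pow_le, Cmod_ge_0|].
  apply Rmult_le_compat_l; [|exact HK].
  apply Rlt_le, Rinv_0_lt_compat, pow_lt; assumption.
Qed.

Lemma is_series_circle_coef :
  is_series (V := C_R_NormedModule) (fun n => Cpow w n * circle_coef r n)%C ((2 * PI)%R * f w)%C.
Proof.
destruct remainder_bound as [M HM].
assert (Hr := radius_pos r w w_small); assert (Hw := Cmod_ge_0 w).
assert (Hq : is_lim_seq (fun n => M * (Cmod w / r) ^ S n) 0).
{ replace (Finite 0) with (Rbar_mult M 0) by (simpl; f_equal; ring).
  apply is_lim_seq_scal_l.
  apply (is_lim_seq_incr_1 (fun n => (Cmod w / r) ^ n)).
  apply is_lim_seq_geom.
  rewrite Rabs_pos_eq; [|apply Rdiv_le_0_compat; lra].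
  apply (Rmult_lt_reg_r r); [assumption|]; unfold Rdiv; rewrite Rmult_assoc Rinv_l; lra. }
apply (filterlim_locally_ball_norm (U := C_R_NormedModule)); intros eps.
assert (Hq' := proj1 (filterlim_locally (U := R_UniformSpace) _ _) Hq eps).
generalize Hq'; apply filter_imp; intros n Hn.
change (norm (V := C_R_NormedModule) (sum_n (G := C_AbelianMonoid) (fun k => Cpow w k * circle_coef
  r k)%C n - (2 * PI)%R * f w)%C < eps).
rewrite norm_C_R -Cmod_opp Copp_minus_distr.
apply Rle_lt_trans with (1 := HM n).
change (Rabs (M * (Cmod w / r) ^ S n - 0) < eps) in Hn.
rewrite Rminus_0_r in Hn; apply Rle_lt_trans with (2 := Hn); apply Rle_abs.
Qed.

End Taylor.

(** * Taylor series *)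

Lemma is_series_linear {V W : NormedModule R_AbsRing} (L : V -> W) (u : nat -> V) (l : V) :
  is_linear L -> is_series u l -> is_series (fun n => L (u n)) (L l).
Proof.
intros HL Hu.
apply (filterlim_ext (fun n => L (sum_n u n))).
- induction x as [|n IH]; [now rewrite !sum_O|].
  rewrite !sum_Sn -IH; apply (linear_plus L HL).
- apply (filterlim_comp _ _ _ _ L _ (locally l)); [exact Hu|].
  now apply (linear_cont L).
Qed.

Lemma ex_pseries_CV_radius (a : nat -> R) (x : R) :
  ex_pseries a x -> Rbar_le (Rabs x) (CV_radius a).
Proof.
intros Hx; apply Rbar_not_lt_le; intros Hlt.
apply (CV_disk_outside a x Hlt).
apply (is_lim_seq_ext (fun n => scal (pow_n x n) (a n))).
- intros n; rewrite pow_n_pow; apply Rmult_comm.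
- now apply ex_series_lim_0.
Qed.

Lemma pseries_unique (a b : nat -> R) (r : R) (F : R -> R) : 0 < r ->
  (forall x, Rabs x < r -> is_pseries a x (F x)) ->
  (forall x, Rabs x < r -> is_pseries b x (F x)) -> forall n, a n = b n.
Proof.
intros Hr Ha Hb n.
assert (H2 : Rabs (r / 2) = r / 2) by (apply Rabs_pos_eq; lra).
assert (CV : forall c, (forall x, Rabs x < r -> is_pseries c x (F x)) -> Rbar_lt 0 (CV_radius c)).
(* Convergence is assumed only inside the radius [r], so it is tested at [r / 2]. *)
{ intros c Hc; apply Rbar_lt_le_trans with (Finite (Rabs (r / 2))); [simpl; lra|].
  apply ex_pseries_CV_radius; eexists; apply Hc; lra. }
assert (E := Derive_n_coef a n (CV a Ha)).
rewrite (Derive_n_ext_loc (PSeries a) (PSeries b)) in E.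
- rewrite (Derive_n_coef b n (CV b Hb)) in E.
  symmetry; apply (Rmult_eq_reg_r _ _ _ E), INR_fact_neq_0.
- exists (mkposreal r Hr); intros x Hx.
  change (Rabs (x - 0) < r) in Hx; rewrite Rminus_0_r in Hx.
  rewrite (is_pseries_unique _ _ _ (Ha x Hx)); now rewrite (is_pseries_unique _ _ _ (Hb x Hx)).
Qed.

Lemma Cpow_RtoC (x : R) n : Cpow x n = RtoC (x ^ n).
Proof. induction n as [|n IH]; [reflexivity|]; simpl; now rewrite IH RtoC_mult. Qed.

Lemma is_linear_C_fst : is_linear (U := C_R_NormedModule) (V := R_NormedModule) fst.
Proof. exact (is_linear_fst (U := R_NormedModule) (V := R_NormedModule)). Qed.

Lemma is_linear_C_snd : is_linear (U := C_R_NormedModule) (V := R_NormedModule) snd.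
Proof. exact (is_linear_snd (U := R_NormedModule) (V := R_NormedModule)). Qed.

Lemma C_series_unique (u v : nat -> C) (r : R) (F : R -> C) : 0 < r ->
  (forall x : R, Rabs x < r -> is_series (V := C_R_NormedModule) (fun n => Cpow x n * u n)%C (F x))
    ->
  (forall x : R, Rabs x < r -> is_series (V := C_R_NormedModule) (fun n => Cpow x n * v n)%C (F x))
    ->
  forall n, u n = v n.
Proof.
intros Hr Hu Hv.
assert (P : forall L : C -> R, is_linear (U := C_R_NormedModule) (V := R_NormedModule) L ->
  forall n, L (u n) = L (v n)).
{ intros L HL; apply (pseries_unique _ _ r (fun x => L (F x)) Hr).
  - intros x Hx.
    apply (is_series_ext (V := R_NormedModule)) with (2 := is_series_linear L _ _ HL (Hu x Hx)).
    intros n; rewrite Cpow_RtoC -scal_C_R pow_n_pow;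
    apply (linear_scal (U := C_R_NormedModule) (V := R_NormedModule) L HL).
  - intros x Hx.
    apply (is_series_ext (V := R_NormedModule)) with (2 := is_series_linear L _ _ HL (Hv x Hx)).
    intros n; rewrite Cpow_RtoC -scal_C_R pow_n_pow;
    apply (linear_scal (U := C_R_NormedModule) (V := R_NormedModule) L HL). }
intros n; rewrite (surjective_pairing (u n)) (surjective_pairing (v n)); f_equal; apply P.
- exact is_linear_C_fst.
- exact is_linear_C_snd.
Qed.

Theorem taylor (f : C -> C) : (forall z, exists l, C_diff f z l) ->
  exists u : nat -> C, forall z,
    is_series (V := C_R_NormedModule) (fun n => Cpow z n * u n)%C (f z).
Proof.
intros Hf.
exists (fun n => circle_coef f 1 n * RtoC (/ (2 * PI)))%C; intros z.
assert (HPI := PI_RGT_0); assert (Hz := Cmod_ge_0 z).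
set (r := Cmod z + 1).
(* The circle has to enclose [z], but the coefficients must not depend on [z]: for the radii [r] and
   1 both series represent [2 * PI * f] on the real interval from -1 to 1, hence they have the same
   coefficients. *)
assert (E : forall n, circle_coef f r n = circle_coef f 1 n).
{ apply (C_series_unique _ _ 1 (fun x : R => ((2 * PI)%R * f x)%C)); [lra| |];
  intros x Hx; apply is_series_circle_coef; try assumption; rewrite Cmod_R; unfold r; lra. }
assert (H := is_series_circle_coef f Hf r z ltac:(unfold r; lra)).
apply (is_series_scal (V := C_R_NormedModule) (/ (2 * PI))) in H.
assert (E2 : (RtoC (/ (2 * PI)) * ((2 * PI)%R * f z) = f z)%C).
{ rewrite Cmult_assoc -RtoC_mult Rinv_l; [|lra]; apply Cmult_1_l. }
rewrite scal_C_R E2 in H.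
apply (is_series_ext (V := C_R_NormedModule)) with (2 := H).
intros n; rewrite scal_C_R E; match goal with |- ?a = ?b => change (@eq C a b) end; ring.
Qed.

(** * Quaternions *)

Definition Hnorm (q : H) : R := norm (V := H_NormedModule) q.

Lemma H_multE (a b c d a' b' c' d' : R) :
  mult ((a, b, c, d) : H) ((a', b', c', d') : H) =
  (a * a' - b * b' - c * c' - d * d',
   a * b' + b * a' + c * d' - d * c',
   a * c' - b * d' + c * a' + d * b',
   a * d' + b * c' - c * b' + d * a').
Proof. reflexivity. Qed.

Lemma H_oppE (a b c d : R) : opp ((a, b, c, d) : H) = (- a, - b, - c, - d).
Proof. reflexivity. Qed.

Lemma H_eq (a b c d a' b' c' d' : R) :
  a = a' -> b = b' -> c = c' -> d = d' -> (a, b, c, d) = (a', b', c', d') :> H.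
Proof. now intros -> -> -> ->. Qed.

Ltac H_destruct := repeat match goal with
  | q : H |- _ => destruct q as [[[? ?] ?] ?]
  | q : Ring.sort H_Ring |- _ => destruct q as [[[? ?] ?] ?]
  | q : AbelianMonoid.sort H_AbelianMonoid |- _ => destruct q as [[[? ?] ?] ?]
  | q : ModuleSpace.sort _ H_ModuleSpace |- _ => destruct q as [[[? ?] ?] ?]
  | q : NormedModule.sort _ H_NormedModule |- _ => destruct q as [[[? ?] ?] ?]
  end.

Ltac Hring := intros; H_destruct;
  cbv -[Rplus Rmult Ropp Rminus Rinv IZR]; apply H_eq; ring.

Lemma Hnorm_sqr (a b c d : R) : Hnorm (a, b, c, d) = sqrt (a * a + b * b + c * c + d * d).
Proof.
change (Hnorm (a, b, c, d)) with
  (sqrt (sqrt (sqrt (Rabs a ^ 2 + Rabs b ^ 2) ^ 2 + Rabs c ^ 2) ^ 2 + Rabs d ^ 2)).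
rewrite !pow2_abs.
assert (Ha := pow2_ge_0 a); assert (Hb := pow2_ge_0 b); assert (Hc := pow2_ge_0 c).
rewrite (pow2_sqrt (a ^ 2 + b ^ 2)); [|lra].
rewrite pow2_sqrt; [|lra].
f_equal; ring.
Qed.

(** Euler's four-square identity. *)
Lemma Hnorm_mult (p q : H) : Hnorm (mult p q) = Hnorm p * Hnorm q.
Proof.
H_destruct; rewrite H_multE !Hnorm_sqr -sqrt_mult; [f_equal; ring| |]; nra.
Qed.

Lemma Hmult_scal_l (x : R) (p q : H) : mult (scal x p) q = scal x (mult p q) :> H.
Proof. Hring. Qed.

Lemma Hmult_scal_r (x : R) (p q : H) : mult p (scal x q) = scal x (mult p q) :> H.
Proof. Hring. Qed.

Lemma RtoH_scal (x : R) (q : H) : mult (RtoH x) q = scal x q :> H.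
Proof. Hring. Qed.

Lemma pow_n_RtoH (x : R) n : pow_n (RtoH x : H_Ring) n = RtoH (x ^ n).
Proof.
induction n as [|n IH]; [reflexivity|]; simpl.
rewrite IH RtoH_scal; unfold RtoH; rewrite H_scalE; apply H_eq; ring.
Qed.

Lemma Sph_coords (I : Sph) : exists b c d : R,
  Sph_val I = (0, b, c, d) /\ b * b + c * c + d * d = 1.
Proof.
destruct I as [[[[a b] c] d] HI]; simpl.
rewrite H_multE in HI; change (opp one) with ((- (1), - 0, - 0, - 0) : H) in HI; injection HI;
intros H3 H2 H1 H0.
assert (Ha : a = 0).
{ destruct (Req_dec a 0) as [|Ha]; [assumption|exfalso].
  assert (b = 0) by (apply (Rmult_eq_reg_l a); lra).
  assert (c = 0) by (apply (Rmult_eq_reg_l a); lra).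
  assert (d = 0) by (apply (Rmult_eq_reg_l a); lra).
  subst; nra. }
exists b, c, d; split; [now rewrite Ha|subst; lra].
Qed.

Lemma Sph_intro (b c d : R) : b * b + c * c + d * d = 1 ->
  exists K : Sph, Sph_val K = (0, b, c, d).
Proof.
intros E.
assert (HK : mult ((0, b, c, d) : H) (0, b, c, d) = opp one).
{ rewrite H_multE; unfold one; simpl; unfold RtoH; rewrite H_oppE; apply H_eq; lra. }
now exists (exist (fun K : H => mult K K = opp one) (0, b, c, d) HK).
Qed.

Lemma Sph_sqr (I : Sph) : mult (I : H) (I : H) = opp one.
Proof. exact (proj2_sig I). Qed.

Lemma Sph_norm (I : Sph) : Hnorm I = 1.
Proof.
destruct (Sph_coords I) as (b & c & d & -> & E).
rewrite Hnorm_sqr Rmult_0_l Rplus_0_l E; apply sqrt_1.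
Qed.

Lemma orthogonal_anticommute (I J : Sph) : orthogonal I J ->
  mult (J : H) (I : H) = opp (mult (I : H) (J : H)).
Proof.
unfold orthogonal.
destruct (Sph_coords I) as (b & c & d & -> & _), (Sph_coords J) as (b' & c' & d' & -> & _).
simpl; intros E; rewrite !H_multE H_oppE; apply H_eq; lra.
Qed.

Lemma orthogonal_exists (I : Sph) : exists J : Sph, orthogonal I J.
Proof.
destruct (Sph_coords I) as (b & c & d & E & E1); unfold orthogonal.
destruct (Req_dec (b * b + c * c) 0) as [H0|H0].
- destruct (Sph_intro 1 0 0) as [J HJ]; [ring|]; exists J; rewrite HJ E; simpl.
  assert (b = 0) by nra; subst; ring.
- assert (Hpos : 0 < b * b + c * c) by nra.
  set (n := sqrt (b * b + c * c)).
  assert (Hn : 0 < n) by now apply sqrt_lt_R0.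
  assert (Hnn : n * n = b * b + c * c) by (apply sqrt_sqrt; lra).
  destruct (Sph_intro (- c / n) (b / n) 0) as [J HJ].
  + replace (- c / n * (- c / n) + b / n * (b / n) + 0 * 0) with ((b * b + c * c) / (n * n)) by
      (field; lra).
    rewrite Hnn; field; lra.
  + exists J; rewrite HJ E; simpl; field; lra.
Qed.

Lemma H_slice_exists (q : H) : exists (K : Sph) (x y : R), q = slice K x y.
Proof.
destruct q as [[[a b] c] d].
destruct (Req_dec (b * b + c * c + d * d) 0) as [H0|H0].
(* A real quaternion lies on every slice; any unit will do. *)
- destruct (Sph_intro 1 0 0) as [K HK]; [ring|]; exists K, a, 0.
  unfold slice, RtoH; rewrite HK H_scalE H_plusE.
  assert (b = 0) by nra; assert (c = 0) by nra; assert (d = 0) by nra.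
  apply H_eq; lra.
- assert (Hpos : 0 < b * b + c * c + d * d) by nra.
  set (n := sqrt (b * b + c * c + d * d)).
  assert (Hn : 0 < n) by now apply sqrt_lt_R0.
  assert (Hnn : n * n = b * b + c * c + d * d) by (apply sqrt_sqrt; lra).
  destruct (Sph_intro (b / n) (c / n) (d / n)) as [K HK].
  + replace (b / n * (b / n) + c / n * (c / n) + d / n * (d / n)) with ((b * b + c * c + d * d) /
      (n * n)) by (field; lra).
    rewrite Hnn; field; lra.
  + exists K, a, n; unfold slice, RtoH; rewrite HK H_scalE H_plusE; apply H_eq; field; lra.
Qed.

(** * The slices as copies of the complex plane *)

Definition emb (I : H) (z : C) : H := slice I (fst z) (snd z).

Lemma embE (I : H) (z : C) : CI_val I (CI_of_C I z) = emb I z.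
Proof. reflexivity. Qed.

Lemma emb_plus (I : H) (z w : C) : emb I (z + w)%C = plus (emb I z) (emb I w).
Proof. destruct z, w; unfold emb; simpl; Hring. Qed.

Lemma emb_opp (I : H) (z : C) : emb I (- z)%C = opp (emb I z).
Proof. destruct z; unfold emb; simpl; Hring. Qed.

Lemma emb_RtoC (I : H) (x : R) : emb I x = RtoH x.
Proof. unfold emb; simpl; Hring. Qed.

Lemma emb_mult (I : Sph) (z w : C) : emb I (z * w)%C = mult (emb I z) (emb I w).
Proof.
destruct z as [x y], w as [x' y']; unfold emb, slice; simpl.
destruct (Sph_coords I) as (b & c & d & -> & E).
unfold RtoH; rewrite !H_scalE !H_plusE H_multE; apply H_eq; try ring.
replace (0 + y * b) with (y * b) by ring; replace (0 + y * c) with (y * c) by ring;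
replace (0 + y * d) with (y * d) by ring.
transitivity (x * x' - y * y' * (b * b + c * c + d * d)); [rewrite E|]; ring.
Qed.

Lemma emb_pow (I : Sph) (z : C) n : emb I (Cpow z n) = pow_n (emb I z : H_Ring) n.
Proof.
induction n as [|n IH]; simpl; [apply emb_RtoC|].
now rewrite emb_mult IH.
Qed.

Lemma emb_norm (I : Sph) (z : C) : Hnorm (emb I z) = Cmod z.
Proof.
destruct z as [x y]; unfold emb, slice, Cmod; simpl.
destruct (Sph_coords I) as (b & c & d & -> & E).
unfold RtoH; rewrite H_scalE H_plusE Hnorm_sqr; f_equal.
transitivity (x * x + y * y * (b * b + c * c + d * d)); [|rewrite E]; ring.
Qed.

Lemma emb_conj (I : Sph) (z : C) : Hconj (emb I z) = emb I (Cconj z).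
Proof.
destruct z as [x y]; unfold emb, slice, Cconj; simpl.
destruct (Sph_coords I) as (b & c & d & -> & E).
cbv -[Rplus Rmult Ropp Rminus Rinv IZR]; apply H_eq; ring.
Qed.

Definition coords (I : H) (q : H) : C := (Hdot q one, Hdot q I).

(** The centralizer of [I] is [C_I]: commuting with [I] means that the imaginary part of [q] has
    zero cross product with [I], so the orthogonal projection [coords] loses nothing. *)
Lemma emb_coords (I : Sph) (q : H) :
  mult q (I : H) = mult (I : H) q -> emb I (coords I q) = q.
Proof.
destruct (Sph_coords I) as (b & c & d & HI & E).
destruct q as [[[x y] z] t]; unfold coords, emb, slice, one; rewrite HI; simpl.
rewrite !H_multE; unfold RtoH; rewrite H_scalE H_plusE; intros HE.
assert (E1 := f_equal (fun q : H => snd (fst (fst q))) HE).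
assert (E2 := f_equal (fun q : H => snd (fst q)) HE).
assert (E3 := f_equal (fun q : H => snd q) HE).
cbv -[Rplus Rmult Ropp Rminus Rinv IZR] in E1, E2, E3.
assert (X1 : z * d = t * c) by lra.
assert (X2 : t * b = y * d) by lra.
assert (X3 : y * c = z * b) by lra.
apply H_eq; [ring| | |].
- transitivity (y * (b * b + c * c + d * d)); [|rewrite E; ring].
  transitivity (b * (y * b) + b * (z * c) + d * (t * b)); [ring|rewrite X2].
  transitivity (b * (y * b) + c * (z * b) + d * (y * d)); [ring|rewrite -X3; ring].
- transitivity (z * (b * b + c * c + d * d)); [|rewrite E; ring].
  transitivity (b * (y * c) + c * (z * c) + d * (t * c)); [ring|rewrite X3 -X1; ring].
- transitivity (t * (b * b + c * c + d * d)); [|rewrite E; ring].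
  transitivity (b * (y * d) + c * (z * d) + d * (t * d)); [ring|rewrite -X2 X1; ring].
Qed.

(** * Slice regular functions as power series *)

Lemma filterdiff_locallyP {K : AbsRing} {U V : NormedModule K} (f : U -> V) (x : U) (l : U -> V) :
  filterdiff f (locally x) l <->
  is_linear l /\ forall eps, 0 < eps -> exists delta, 0 < delta /\ forall y,
    norm (minus y x) < delta ->
    norm (minus (minus (f y) (f x)) (l (minus y x))) <= eps * norm (minus y x).
Proof.
split.
- intros [Hl H]; split; [assumption|]; intros eps Heps.
  specialize (H x (fun P h => h) (mkposreal eps Heps)).
  destruct (locally_norm_le_locally x _ H) as [d Hd].
  exists d; split; [apply d|exact Hd].
- intros [Hl H]; split; [assumption|]; intros x' Hx'.
  rewrite -(is_filter_lim_locally_unique x x' Hx'); intros [eps Heps].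
  destruct (H eps Heps) as [d [Hd Hy]].
  apply locally_le_locally_norm; exists (mkposreal d Hd); exact Hy.
Qed.

Lemma C_diff_absP (f : C -> C) (z l : C) :
  is_derive (K := C_AbsRing) (V := AbsRing_NormedModule C_AbsRing) f z l <-> C_diff f z l.
Proof.
assert (E : forall y, minus (minus (f y) (f z)) (scal (minus y z) l) = (f y - f z - l * (y - z))%C).
{ intros y; change ((f y - f z) - (y - z) * l = f y - f z - l * (y - z))%C; ring. }
assert (Q := filterdiff_locallyP (U := AbsRing_NormedModule C_AbsRing) (V := AbsRing_NormedModule
  C_AbsRing) f z
  (fun y => scal y l)).
split.
- intros Hf; apply Q in Hf; destruct Hf as [_ Hf]; intros eps Heps.
  destruct (Hf eps Heps) as [d [Hd Hy]]; exists d; split; [assumption|].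
  intros y Hyd; rewrite -E; now apply Hy.
- intros Hf; apply Q; split; [exact (is_linear_scal_l (V := AbsRing_NormedModule C_AbsRing) l)|].
  intros eps Heps; destruct (Hf eps Heps) as [d [Hd Hy]]; exists d; split; [assumption|].
  intros y Hyd.
  change (Cmod (minus (minus (f y) (f z)) (scal (minus y z) l)) <= eps * Cmod (y - z)).
  rewrite E; now apply Hy.
Qed.

(** [entire] uses one normed module structure on [C], the rules for sums and products another. Their
    norms agree, so the epsilon parts of the two derivatives are interchangeable. *)
Lemma C_diffP (f : C -> C) (z l : C) :
  is_derive (K := C_AbsRing) (V := C_NormedModule) f z l <-> C_diff f z l.
Proof.
rewrite -C_diff_absP.
assert (Q := filterdiff_locallyP (U := AbsRing_NormedModule C_AbsRing) (V := C_NormedModule) f z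
  (fun y => scal y (l : C_NormedModule))).
assert (Q' := filterdiff_locallyP (U := AbsRing_NormedModule C_AbsRing)
  (V := AbsRing_NormedModule C_AbsRing) f z (fun y => scal y l)).
split; intros Hd.
- apply Q'; split; [exact (is_linear_scal_l (V := AbsRing_NormedModule C_AbsRing) l)|].
  exact (proj2 (proj1 Q Hd)).
- apply Q; split; [exact (is_linear_scal_l (V := C_NormedModule) l)|].
  exact (proj2 (proj1 Q' Hd)).
Qed.

Definition R_diff (f : R -> H) (x : R) (l : H) : Prop :=
  forall eps, 0 < eps -> exists delta, 0 < delta /\ forall t, Rabs (t - x) < delta ->
    Hnorm (minus (minus (f t) (f x)) (scal (t - x) l)) <= eps * Rabs (t - x).

Lemma R_diffP (f : R -> H) (x : R) (l : H) :
  is_derive (K := R_AbsRing) (V := H_NormedModule) f x l <-> R_diff f x l.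
Proof.
assert (Q := filterdiff_locallyP (U := R_NormedModule) (V := H_NormedModule) f x (fun y => scal y
  l)).
split.
- intros H; exact (proj2 (proj1 Q H)).
- intros H; apply Q; split; [apply (is_linear_scal_l (V := H_NormedModule))|exact H].
Qed.

Definition H_diff (f : H -> H) (q : H) (L : H -> H) : Prop :=
  forall eps, 0 < eps -> exists delta, 0 < delta /\ forall p : H, Hnorm (minus p q) < delta ->
    Hnorm (minus (minus (f p) (f q)) (L (minus p q))) <= eps * Hnorm (minus p q).

Lemma H_diffP (f : H -> H) (q : H) (L : H -> H) :
  filterdiff (K := R_AbsRing) (U := H_NormedModule) (V := H_NormedModule) f (locally q) L <->
  is_linear (U := H_NormedModule) (V := H_NormedModule) L /\ H_diff f q L.
Proof. exact (filterdiff_locallyP (U := H_NormedModule) (V := H_NormedModule) f q L). Qed.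

Lemma Hnorm_ge_0 q : 0 <= Hnorm q.
Proof. apply (norm_ge_0 (V := H_NormedModule)). Qed.

Lemma Hnorm_triangle p q : Hnorm (plus p q) <= Hnorm p + Hnorm q.
Proof. apply (norm_triangle (V := H_NormedModule)). Qed.

Lemma Hnorm_opp q : Hnorm (opp q) = Hnorm q.
Proof. apply (norm_opp (V := H_NormedModule)). Qed.

Lemma Hnorm_zero : Hnorm zero = 0.
Proof. apply (norm_zero (V := H_NormedModule)). Qed.

Lemma Hnorm_eq_0 q : Hnorm q = 0 -> q = zero.
Proof. apply (norm_eq_zero (V := H_NormedModule)). Qed.

Lemma Hnorm_RtoH x : Hnorm (RtoH x) = Rabs x.
Proof. unfold RtoH; rewrite Hnorm_sqr -sqrt_Rsqr_abs; f_equal; unfold Rsqr; ring. Qed.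

Lemma Hnorm_one : Hnorm one = 1.
Proof. exact (eq_trans (Hnorm_RtoH 1) Rabs_R1). Qed.

Lemma Hnorm_scal x q : Hnorm (scal x q) = Rabs x * Hnorm q.
Proof. now rewrite -RtoH_scal Hnorm_mult Hnorm_RtoH. Qed.

Lemma Hminus_eq_0 (p q : H) : minus p q = zero -> p = q.
Proof.
intros E; rewrite -(plus_zero_l (G := H_AbelianMonoid) q) -E.
unfold minus; rewrite -plus_assoc (plus_opp_l (G := H_AbelianGroup)).
now rewrite (plus_zero_r (G := H_AbelianMonoid)).
Qed.

Lemma R_diff_unique f x l l' : R_diff f x l -> R_diff f x l' -> l = l'.
Proof.
intros H H'; apply Hminus_eq_0, Hnorm_eq_0.
apply Rle_antisym; [|apply Hnorm_ge_0].
apply le_epsilon; intros e He; rewrite Rplus_0_l.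
destruct (H (e / 2)) as [d [Hd H1]]; [lra|].
destruct (H' (e / 2)) as [d' [Hd' H1']]; [lra|].
set (h := Rmin d d' / 2).
assert (Hm := Rmin_pos _ _ Hd Hd').
assert (Hm1 := Rmin_l d d'); assert (Hm2 := Rmin_r d d').
assert (Hh : Rabs (x + h - x) = h).
{ replace (x + h - x) with h by ring; apply Rabs_pos_eq; unfold h; lra. }
specialize (H1 (x + h)); specialize (H1' (x + h)); rewrite Hh in H1, H1'.
specialize (H1 ltac:(unfold h; lra)); specialize (H1' ltac:(unfold h; lra)).
apply (Rmult_le_reg_l h); [unfold h; lra|].
rewrite -{1}Hh -Hnorm_scal.
assert (E : scal (x + h - x) (minus l l') =
  plus (minus (minus (f (x + h)) (f x)) (scal (x + h - x) l'))
       (opp (minus (minus (f (x + h)) (f x)) (scal (x + h - x) l)))).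
{ generalize (f (x + h)) (f x); Hring. }
rewrite E; apply Rle_trans with (1 := Hnorm_triangle _ _); rewrite Hnorm_opp; lra.
Qed.

Lemma H_diff_line f q L h (g : R -> H) x :
  is_linear (U := H_NormedModule) (V := H_NormedModule) L -> H_diff f q L ->
  Hnorm h = 1 -> (forall t, minus (g t) q = scal (t - x) h) ->
  R_diff (fun t => f (g t)) x (L h).
Proof.
intros HL Hf Hh Hg eps Heps.
destruct (Hf eps Heps) as [d [Hd H]]; exists d; split; [assumption|]; intros t Ht.
assert (E : Hnorm (minus (g t) q) = Rabs (t - x)) by (rewrite Hg Hnorm_scal Hh; ring).
specialize (H (g t)); rewrite E in H; specialize (H Ht).
assert (Eg : g x = q).
{ apply Hminus_eq_0; rewrite Hg Rminus_diag; apply (scal_zero_l (V := H_ModuleSpace)). }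
rewrite Eg; rewrite Hg in H.
now rewrite (linear_scal L HL) in H.
Qed.

(** Pointwise Cauchy-Riemann equations for partial derivatives do not imply complex
    differentiability; the real differential [L] fills the gap. Since [L one = dx] and
    [L I = dy = I dx], it acts on [C_I] as [h] goes to [h dx]. *)
Lemma slice_regular_H_diff (f : H -> H) (I : Sph) (z : C) : slice_regular f ->
  exists l : H, forall eps, 0 < eps -> exists delta, 0 < delta /\ forall y, Cmod (y - z) < delta ->
    Hnorm (minus (minus (f (emb I y)) (f (emb I z))) (mult (emb I (y - z)%C) l)) <= eps * Cmod (y -
      z).
Proof.
intros [Hreal Hs].
destruct (Hreal (emb I z)) as [L HL]; apply H_diffP in HL; destruct HL as [Hlin HL].
destruct (Hs I (fst z) (snd z)) as (dx & dy & Hx & Hy & HCR).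
apply R_diffP in Hx, Hy.
assert (Ex : dx = L one).
{ apply (R_diff_unique _ _ _ _ Hx).
  apply (H_diff_line f (emb I z)); try assumption.
  - exact Hnorm_one.
  - intros t; unfold emb; generalize (fst z) (snd z) (Sph_val I); Hring. }
assert (Ey : dy = L (I : H)).
{ apply (R_diff_unique _ _ _ _ Hy).
  apply (H_diff_line f (emb I z)); try assumption.
  - apply Sph_norm.
  - intros t; unfold emb; generalize (fst z) (snd z) (Sph_val I); Hring. }
assert (Edy : dy = mult (I : H) dx).
{ assert (E0 : plus dx (mult (I : H) dy) = zero).
  { transitivity (scal 2 (scal (1 / 2) (plus dx (mult (I : H) dy)))).
    - rewrite (scal_assoc (V := H_ModuleSpace)).
      replace (mult 2 (1 / 2)) with (one : R_Ring) by (unfold mult, one; simpl; field).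
      symmetry; apply (scal_one (V := H_ModuleSpace)).
    - rewrite HCR; apply (scal_zero_r (V := H_ModuleSpace)). }
  apply Hminus_eq_0.
  transitivity (opp (mult (I : H) (plus dx (mult (I : H) dy)))).
  - rewrite (mult_distr_l (K := H_Ring)) (mult_assoc (K := H_Ring)) Sph_sqr.
    generalize (mult (I : H) dx : H) dy; Hring.
  - rewrite E0; generalize (Sph_val I); Hring. }
exists dx; intros eps Heps; destruct (HL eps Heps) as [d [Hd Hb]].
exists d; split; [assumption|]; intros y Hyd.
assert (Em : minus (emb I y) (emb I z) = emb I (y - z)%C).
{ unfold Cminus; now rewrite emb_plus emb_opp. }
specialize (Hb (emb I y)); rewrite Em emb_norm in Hb; specialize (Hb Hyd).
replace (mult (emb I (y - z)%C) dx) with (L (emb I (y - z)%C)); [assumption|].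
generalize (y - z)%C; intros h.
assert (Eh : emb I h = plus (scal (fst h) (one : H)) (scal (snd h) (I : H))).
{ unfold emb; generalize (fst h) (snd h) (Sph_val I); Hring. }
rewrite {1}Eh (linear_plus L Hlin) !(linear_scal L Hlin) -Ex -Ey Edy.
unfold emb; generalize (fst h) (snd h) (Sph_val I) dx; Hring.
Qed.

(** * The splitting of quaternions along [I] and [J] *)

Section Splitting.

Variables I J : Sph.
Hypothesis I_orth_J : orthogonal I J.

Definition sp (z w : C) : H := plus (emb I z) (mult (emb I w) (J : H)).

(* [1, I, J, I J] is an orthonormal basis. *)
Lemma sp_norm z w : Hnorm (sp z w) = sqrt (Cmod z ^ 2 + Cmod w ^ 2).
Proof.
destruct z as [x y], w as [x' y'].
unfold sp, emb, slice, Cmod.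
generalize I_orth_J; unfold orthogonal.
destruct (Sph_coords I) as (b & c & d & -> & E), (Sph_coords J) as (b' & c' & d' & -> & E').
simpl; intros E0.
match goal with |- Hnorm ?q = _ =>
  let q' := eval cbv -[Rplus Rmult Ropp Rminus Rinv IZR] in q in change q with q' end.
rewrite Hnorm_sqr.
rewrite !Rmult_1_r !sqrt_sqrt; [|nra|nra].
f_equal.
transitivity (x * x + y * y * (b * b + c * c + d * d) + x' * x' * (b' * b' + c' * c' + d' * d')
  + y' * y' * ((b * b + c * c + d * d) * (b' * b' + c' * c' + d' * d'))
  + 2 * (y * x' - x * y') * (0 * 0 + b * b' + c * c' + d * d')); [ring|].
rewrite E E' E0; ring.
Qed.

Lemma Cmod_sp_l z w : Cmod z <= Hnorm (sp z w).
Proof.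
rewrite sp_norm -{1}(sqrt_pow2 (Cmod z)); [|apply Cmod_ge_0].
apply sqrt_le_1_alt; assert (H := pow2_ge_0 (Cmod w)); lra.
Qed.

Lemma Cmod_sp_r z w : Cmod w <= Hnorm (sp z w).
Proof.
rewrite sp_norm -{1}(sqrt_pow2 (Cmod w)); [|apply Cmod_ge_0].
apply sqrt_le_1_alt; assert (H := pow2_ge_0 (Cmod z)); lra.
Qed.

Lemma sp_plus z w z' w' : sp (z + z') (w + w') = plus (sp z w) (sp z' w').
Proof.
unfold sp; rewrite !emb_plus; generalize (emb I z) (emb I w) (emb I z') (emb I w') (Sph_val J);
Hring.
Qed.

Lemma sp_opp z w : sp (- z) (- w) = opp (sp z w).
Proof. unfold sp; rewrite !emb_opp; generalize (emb I z) (emb I w) (Sph_val J); Hring. Qed.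

Lemma sp_minus z w z' w' : sp (z - z') (w - w') = minus (sp z w) (sp z' w').
Proof. unfold Cminus; now rewrite sp_plus sp_opp. Qed.

Lemma sp_mult_l c z w : sp (c * z) (c * w) = mult (emb I c) (sp z w).
Proof.
unfold sp; rewrite !emb_mult; generalize (emb I z) (emb I w) (emb I c) (Sph_val J); Hring.
Qed.

Lemma sp_scal x z w : sp (RtoC x * z) (RtoC x * w) = scal x (sp z w).
Proof. now rewrite sp_mult_l emb_RtoC RtoH_scal. Qed.

Lemma sp_inj z w z' w' : sp z w = sp z' w' -> z = z' /\ w = w'.
Proof.
intros E.
assert (E0 : sp (z - z') (w - w') = zero).
{ rewrite sp_minus E; apply (minus_eq_zero (G := H_AbelianGroup)). }
split; apply Cminus_eq_0, Cmod_eq_0, Rle_antisym; try apply Cmod_ge_0; rewrite -Hnorm_zero -E0.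
- apply Cmod_sp_l.
- apply Cmod_sp_r.
Qed.

(* The part of [q] commuting with [I], and minus the part anticommuting with [I] times [J]. *)
Lemma sp_surj q : exists z w, q = sp z w.
Proof.
assert (HJI := orthogonal_anticommute I J I_orth_J).
assert (HI := Sph_sqr I); assert (HJ := Sph_sqr J).
set (i := Sph_val I) in *; set (j := Sph_val J) in *.
set (p1 := scal (1 / 2) (minus q (mult i (mult q i))) : H).
set (p2 := scal (1 / 2) (opp (mult (plus q (mult i (mult q i))) j)) : H).
assert (E1 : mult p1 i = mult i p1).
{ unfold p1; rewrite Hmult_scal_l Hmult_scal_r; f_equal.
  transitivity (minus (mult q i) (mult i (mult q (mult i i))) : H); [generalize q i; Hring|].
  transitivity (minus (mult i q) (mult (mult i i) (mult q i)) : H); [|generalize q i; Hring].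
  rewrite HI; generalize q i; Hring. }
assert (E2 : mult p2 i = mult i p2).
{ unfold p2; rewrite Hmult_scal_l Hmult_scal_r; f_equal.
  transitivity (opp (mult (plus q (mult i (mult q i))) (mult j i)) : H); [generalize q i j; Hring|].
  rewrite HJI.
  transitivity (plus (mult (mult q i) j) (mult (mult i (mult q (mult i i))) j) : H);
  [generalize q i j; Hring|].
  transitivity (opp (plus (mult (mult i q) j) (mult (mult (mult i i) (mult q i)) j)) : H);
  [|generalize q i j; Hring].
  rewrite HI; generalize q i j; Hring. }
exists (coords I p1), (coords I p2); unfold sp.
rewrite !emb_coords; try assumption; fold j.
unfold p1, p2; rewrite Hmult_scal_l.
transitivity (plus (scal (1 / 2) (minus q (mult i (mult q i))))
  (scal (1 / 2) (opp (mult (plus q (mult i (mult q i))) (mult j j))) : H)); 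
  [|f_equal; f_equal; generalize q i j; Hring].
rewrite HJ.
transitivity (scal (1 / 2) (scal 2 q) : H); [|generalize q i; Hring].
destruct q as [[[q0 q1] q2] q3]; rewrite !H_scalE; apply H_eq; field.
Qed.

Definition split_pair (q : H) : C * C := epsilon (inhabits (RtoC 0, RtoC 0)) (fun p => q = sp (fst
  p) (snd p)).
Definition fst_part (q : H) : C := fst (split_pair q).
Definition snd_part (q : H) : C := snd (split_pair q).

Lemma spK q : sp (fst_part q) (snd_part q) = q.
Proof.
symmetry; apply (epsilon_spec (inhabits (RtoC 0, RtoC 0)) (fun p => q = sp (fst p) (snd p))).
destruct (sp_surj q) as (z & w & E); now exists (z, w).
Qed.

(** Left multiplication by an element of [C_I] acts on both components separately, so the components
    of the derivative are the derivatives of the components; each error is bounded by the norm of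
    the pair. *)
Lemma slice_regular_C_diff (f : H -> H) : slice_regular f ->
  (forall z, exists l, C_diff (fun z => fst_part (f (emb I z))) z l) /\
  (forall z, exists l, C_diff (fun z => snd_part (f (emb I z))) z l).
Proof.
intros Hf.
assert (P : forall z, exists l l' : C, forall eps, 0 < eps -> exists delta, 0 < delta /\
  forall y, Cmod (y - z) < delta ->
  Hnorm (sp (fst_part (f (emb I y)) - fst_part (f (emb I z)) - l * (y - z))
    (snd_part (f (emb I y)) - snd_part (f (emb I z)) - l' * (y - z))) <= eps * Cmod (y - z)).
{ intros z; destruct (slice_regular_H_diff f I z Hf) as [l Hl].
  exists (fst_part l), (snd_part l); intros eps Heps; destruct (Hl eps Heps) as [d [Hd H]].
  exists d; split; [assumption|]; intros y Hy.
  rewrite 2!sp_minus !(Cmult_comm _ (y - z)) sp_mult_l !spK; now apply H. }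
split; intros z; destruct (P z) as (l & l' & Hl).
- exists l; intros eps Heps; destruct (Hl eps Heps) as [d [Hd H]].
  exists d; split; [assumption|]; intros y Hy.
  apply Rle_trans with (2 := H y Hy), Cmod_sp_l.
- exists l'; intros eps Heps; destruct (Hl eps Heps) as [d [Hd H]].
  exists d; split; [assumption|]; intros y Hy.
  apply Rle_trans with (2 := H y Hy), Cmod_sp_r.
Qed.

Lemma is_linear_sp_l : is_linear (U := C_R_NormedModule) (V := H_NormedModule) (fun z => sp z 0%C).
Proof.
split.
- intros x y; rewrite -sp_plus; f_equal; ring.
- intros x y; rewrite scal_C_R.
  transitivity (sp (RtoC x * y) (RtoC x * 0)); [f_equal; ring|apply sp_scal].
- exists 1; split; [lra|]; intros z; change (Hnorm (sp z 0%C) <= 1 * norm z).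
  rewrite sp_norm Cmod_0 norm_C_R; replace (Cmod z ^ 2 + 0 ^ 2) with (Cmod z ^ 2) by ring.
  rewrite sqrt_pow2; [lra|apply Cmod_ge_0].
Qed.

Lemma is_linear_sp_r : is_linear (U := C_R_NormedModule) (V := H_NormedModule) (fun z => sp 0%C z).
Proof.
split.
- intros x y; rewrite -sp_plus; f_equal; ring.
- intros x y; rewrite scal_C_R.
  transitivity (sp (RtoC x * 0) (RtoC x * y)); [f_equal; ring|apply sp_scal].
- exists 1; split; [lra|]; intros z; change (Hnorm (sp 0%C z) <= 1 * norm z).
  rewrite sp_norm Cmod_0 norm_C_R; replace (0 ^ 2 + Cmod z ^ 2) with (Cmod z ^ 2) by ring.
  rewrite sqrt_pow2; [lra|apply Cmod_ge_0].
Qed.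

Lemma is_series_sp (u v : nat -> C) (z F G : C) :
  is_series (V := C_R_NormedModule) (fun n => Cpow z n * u n)%C F ->
  is_series (V := C_R_NormedModule) (fun n => Cpow z n * v n)%C G ->
  is_series (K := R_AbsRing) (V := H_NormedModule)
    (fun n => mult (pow_n (emb I z) n) (sp (u n) (v n))) (sp F G).
Proof.
intros HF HG.
apply (is_series_linear _ _ _ is_linear_sp_l) in HF.
apply (is_series_linear _ _ _ is_linear_sp_r) in HG.
assert (HS := is_series_plus (V := H_NormedModule) _ _ _ _ HF HG).
replace (sp F G) with (plus (sp F 0) (sp 0 G) : H).
- apply (is_series_ext (V := H_NormedModule)) with (2 := HS).
  intros n; rewrite -emb_pow -sp_mult_l.
  change (plus (sp (Cpow z n * u n) 0) (sp 0 (Cpow z n * v n)) = sp (Cpow z n * u n) (Cpow z n * v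
    n)).
  rewrite -sp_plus; f_equal; ring.
- rewrite -sp_plus; f_equal; ring.
Qed.

End Splitting.

Lemma slice_regular_slice_series (f : H -> H) (I : Sph) : slice_regular f ->
  exists a : nat -> H, forall z : C,
    is_series (K := R_AbsRing) (V := H_NormedModule)
      (fun n => mult (pow_n (emb I z) n) (a n)) (f (emb I z)).
Proof.
intros Hf; destruct (orthogonal_exists I) as [J HIJ].
destruct (slice_regular_C_diff I J HIJ f Hf) as [HF HG].
destruct (taylor _ HF) as [u Hu], (taylor _ HG) as [v Hv].
exists (fun n => sp I J (u n) (v n)); intros z.
rewrite -(spK I J HIJ (f (emb I z))).
now apply is_series_sp.
Qed.

(** * Real coordinates and uniqueness of coefficients *)

Definition H_coord (i : nat) (q : H) : R :=
  match i with
  | 0%nat => fst (fst (fst q))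
  | 1%nat => snd (fst (fst q))
  | 2%nat => snd (fst q)
  | _ => snd q
  end.

Lemma Rabs_H_coord_le i (q : H) : Rabs (H_coord i q) <= Hnorm q.
Proof.
destruct q as [[[a b] c] d].
rewrite Hnorm_sqr -sqrt_Rsqr_abs; apply sqrt_le_1_alt; unfold Rsqr.
do 3 (destruct i as [|i]; [simpl; nra|]); simpl; nra.
Qed.

Lemma is_linear_H_coord i : is_linear (U := H_NormedModule) (V := R_NormedModule) (H_coord i).
Proof.
split.
- intros [[[a b] c] d] [[[a' b'] c'] d']; do 3 (destruct i as [|i]; [reflexivity|]); reflexivity.
- intros k [[[a b] c] d]; do 3 (destruct i as [|i]; [reflexivity|]); reflexivity.
- exists 1; split; [lra|]; intros q; rewrite Rmult_1_l; apply Rabs_H_coord_le.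
Qed.

Lemma H_coord_ext (p q : H) : (forall i, H_coord i p = H_coord i q) -> p = q.
Proof.
destruct p as [[[a b] c] d], q as [[[a' b'] c'] d']; intros E.
apply H_eq; [exact (E 0%nat)|exact (E 1%nat)|exact (E 2%nat)|exact (E 3%nat)].
Qed.

Lemma is_pseries_H_coord (a : nat -> H) (x : R) (l : H) i :
  is_series (K := R_AbsRing) (V := H_NormedModule) (fun n => mult (pow_n (RtoH x) n) (a n)) l ->
  is_pseries (fun n => H_coord i (a n)) x (H_coord i l).
Proof.
intros H; apply (is_series_linear _ _ _ (is_linear_H_coord i)) in H.
apply (is_series_ext (V := R_NormedModule)) with (2 := H).
intros n; rewrite pow_n_pow pow_n_RtoH RtoH_scal.
apply (linear_scal (H_coord i) (is_linear_H_coord i)).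
Qed.

Lemma H_series_unique (a b : nat -> H) (F : R -> H) :
  (forall x, is_series (K := R_AbsRing) (V := H_NormedModule) (fun n => mult (pow_n (RtoH x) n) (a
    n)) (F x)) ->
  (forall x, is_series (K := R_AbsRing) (V := H_NormedModule) (fun n => mult (pow_n (RtoH x) n) (b
    n)) (F x)) ->
  a = b.
Proof.
intros Ha Hb; apply functional_extensionality; intros n.
apply H_coord_ext; intros i.
apply (pseries_unique (fun n => H_coord i (a n)) (fun n => H_coord i (b n)) 1 (fun x => H_coord i
  (F x)));
  [lra| |]; intros x _; now apply is_pseries_H_coord.
Qed.

Lemma slice_regular_power_series (f : H -> H) : slice_regular f ->
  exists a, is_power_series f a.
Proof.
intros Hf.
destruct (Sph_intro 1 0 0) as [K0 _]; [ring|].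
destruct (slice_regular_slice_series f K0 Hf) as [a Ha].
exists a; intros q; destruct (H_slice_exists q) as (K & x & y & ->).
destruct (slice_regular_slice_series f K Hf) as [b Hb].
replace a with b; [exact (Hb (x, y))|].
apply (H_series_unique _ _ (fun t => f (RtoH t))); intros t.
- rewrite -(emb_RtoC K); apply Hb.
- rewrite -(emb_RtoC K0); apply Ha.
Qed.

(** Uniqueness of the coefficients turns the choice in [coeff] into the value of any known
    expansion. *)
Lemma coeffE (f : H -> H) (a : nat -> H) : is_power_series f a -> coeff f = a.
Proof.
intros Ha.
assert (Hc : is_power_series f (coeff f)).
{ apply (epsilon_spec (inhabits (fun _ => zero)) (is_power_series f)); now exists a. }
apply (H_series_unique _ _ (fun x => f (RtoH x))); intros x; [apply Hc|apply Ha].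
Qed.

(** * Power series are slice regular *)

Notation H_series := (is_series (K := R_AbsRing) (V := H_NormedModule)).

Lemma H_series_limit_unique (u : nat -> H) (l l' : H) : H_series u l -> H_series u l' -> l = l'.
Proof. apply (filterlim_locally_unique (V := H_NormedModule)). Qed.

Lemma HseriesE (u : nat -> H) (l : H) : H_series u l -> Hseries u = l.
Proof.
intros Hl; apply (H_series_limit_unique u); [|assumption].
apply (epsilon_spec (inhabits zero) (H_series u)); now exists l.
Qed.

Lemma H_series_plus u v l l' :
  H_series u l -> H_series v l' -> H_series (fun n => plus (u n) (v n)) (plus l l').
Proof. exact (is_series_plus (V := H_NormedModule) u v l l'). Qed.

Lemma is_linear_mult_l (p : H) :
  is_linear (U := H_NormedModule) (V := H_NormedModule) (fun q => mult p q).
Proof.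
split.
- intros x y; exact (mult_distr_l (K := H_Ring) p x y).
- intros k x; exact (Hmult_scal_r k p x).
(* The bound of a linear map has to be positive, even for [p = zero]. *)
- exists (Hnorm p + 1); split; [assert (Hp := Hnorm_ge_0 p); lra|]; intros q.
  change (Hnorm (mult p q) <= (Hnorm p + 1) * Hnorm q).
  rewrite Hnorm_mult; assert (Hq := Hnorm_ge_0 q); nra.
Qed.

Lemma H_series_mult_l p u l : H_series u l -> H_series (fun n => mult p (u n)) (mult p l).
Proof. exact (is_series_linear _ u l (is_linear_mult_l p)). Qed.

Lemma H_series_scal x u l : H_series u l -> H_series (fun n => scal x (u n)) (scal x l).
Proof. exact (is_series_scal (V := H_NormedModule) x u l). Qed.

Lemma H_series_opp u l : H_series u l -> H_series (fun n => opp (u n)) (opp l).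
Proof. exact (is_series_opp (V := H_NormedModule) u l). Qed.

Lemma is_linear_scal_H (e : H) :
  is_linear (U := R_NormedModule) (V := H_NormedModule) (fun x => scal x e).
Proof. exact (is_linear_scal_l (V := H_NormedModule) e). Qed.

(** Convergence is obtained coordinate by coordinate, but the bound passes through the norms of the
    partial sums, so that no constant is lost in recombining four coordinates. *)
Lemma H_series_dominated (u : nat -> H) (b : nat -> R) (l : R) :
  (forall n, Hnorm (u n) <= b n) -> is_series b l ->
  exists s, H_series u s /\ Hnorm s <= l.
Proof.
intros Hu Hb.
assert (Hex : forall i, ex_series (fun n => H_coord i (u n))).
{ intros i; apply (ex_series_le (V := R_CompleteNormedModule)) with (b := b); [|now exists l].
  intros n; apply Rle_trans with (2 := Hu n); apply Rabs_H_coord_le. }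
destruct (Hex 0%nat) as [l0 H0], (Hex 1%nat) as [l1 H1], (Hex 2%nat) as [l2 H2], (Hex 3%nat) as [l3
  H3].
apply (is_series_linear _ _ _ (is_linear_scal_H (1, 0, 0, 0))) in H0.
apply (is_series_linear _ _ _ (is_linear_scal_H (0, 1, 0, 0))) in H1.
apply (is_series_linear _ _ _ (is_linear_scal_H (0, 0, 1, 0))) in H2.
apply (is_series_linear _ _ _ (is_linear_scal_H (0, 0, 0, 1))) in H3.
assert (HS := H_series_plus _ _ _ _ (H_series_plus _ _ _ _ H0 H1) (H_series_plus _ _ _ _ H2 H3)).
match type of HS with is_series _ ?x => set (s := x : H) in HS end.
assert (Hs : H_series u s).
{ apply (is_series_ext (V := H_NormedModule)) with (2 := HS); intros n.
  generalize (u n); Hring. }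
exists s; split; [assumption|].
apply (is_lim_seq_le (fun n => Hnorm (sum_n u n)) (sum_n b) (Hnorm s) l).
- intros n; apply Rle_trans with (sum_n (fun k => Hnorm (u k)) n).
  + apply (norm_sum_n_m (V := H_NormedModule)).
  + apply sum_n_m_le; assumption.
- apply (filterlim_comp _ _ _ _ Hnorm _ (locally s)); [exact Hs|].
  apply (filterlim_norm (V := H_NormedModule)).
- exact Hb.
Qed.

Lemma H_series_geometric (u : nat -> H) (M : R) :
  (forall n, Hnorm (u n) <= M * (1 / 2) ^ n) ->
  exists s, H_series u s /\ Hnorm s <= 2 * M.
Proof.
intros Hu; apply (H_series_dominated u _ (2 * M) Hu).
assert (Hg := is_series_geom (1 / 2)); rewrite Rabs_pos_eq in Hg; [|lra].
specialize (Hg ltac:(lra)).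
apply (is_series_scal (V := R_NormedModule) M) in Hg.
replace (2 * M) with (scal M (/ (1 - 1 / 2))); [exact Hg|].
unfold scal; simpl; unfold mult; simpl; field.
Qed.

(** * Powers and their first-order expansion *)

Lemma Hnorm_pow q n : Hnorm (pow_n (q : H_Ring) n) = Hnorm q ^ n.
Proof.
induction n as [|n IH]; simpl.
- exact Hnorm_one.
- now rewrite Hnorm_mult IH.
Qed.

(* The derivative of [q ^ n] in the direction [h]: the sum of [q ^ i h q ^ (n - 1 - i)]. *)
Fixpoint dpow (n : nat) (q h : H) : H :=
  match n with
  | O => zero
  | S n => plus (mult h (pow_n (q : H_Ring) n)) (mult q (dpow n q h))
  end.

Lemma dpow_plus n q h h' : dpow n q (plus h h') = plus (dpow n q h) (dpow n q h').
Proof.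
induction n as [|n IH]; simpl; [Hring|].
rewrite IH; generalize (dpow n q h) (dpow n q h') (pow_n (q : H_Ring) n : H); clear IH; Hring.
Qed.

Lemma dpow_scal n q x h : dpow n q (scal x h) = scal x (dpow n q h).
Proof.
induction n as [|n IH]; simpl; [clear; Hring|].
rewrite IH; generalize (dpow n q h) (pow_n (q : H_Ring) n : H); clear IH; Hring.
Qed.

Lemma dpow_commute n q h : mult q h = mult h q -> dpow n q h = mult h (dpow n q one).
Proof.
intros E; induction n as [|n IH]; simpl; [clear; Hring|].
rewrite IH !(mult_assoc (K := H_Ring)) E (mult_distr_l (K := H_Ring)) (mult_one_l (K := H_Ring)).
now rewrite (mult_assoc (K := H_Ring)).
Qed.

Definition pow_incr_H (q h : H) (n : nat) : H :=
  minus (pow_n (plus q h : H_Ring) n) (pow_n (q : H_Ring) n).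

Lemma pow_bound (q : H) (r : R) n : Hnorm q <= r -> Hnorm (pow_n (q : H_Ring) n) <= r ^ n.
Proof. intros Hq; rewrite Hnorm_pow; apply pow_incr; split; [apply Hnorm_ge_0|assumption]. Qed.

(* [x] is the norm of the increment and [y] the quantity estimated at the exponent [n]. *)
Lemma pow_step (r x y : R) n : 1 <= r -> 0 <= x -> y <= INR n * r ^ n * x ->
  x * r ^ n + r * y <= INR (S n) * r ^ S n * x.
Proof.
intros Hr Hx Hy; rewrite S_INR -tech_pow_Rmult.
assert (Hrn : 1 <= r ^ n) by now apply pow_R1_Rle.
assert (0 <= (r - 1) * (x * r ^ n)) by (apply Rmult_le_pos; [lra|apply Rmult_le_pos; lra]).
assert (r * y <= r * (INR n * r ^ n * x)) by (apply Rmult_le_compat_l; lra).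
lra.
Qed.

(** Each of the [n] terms has [n - 1] factors of norm at most [r]; since [1 <= r], the exponent is
    rounded up to [n] and no subtraction enters the induction. *)
Lemma dpow_bound (q h : H) (r : R) n : 1 <= r -> Hnorm q <= r ->
  Hnorm (dpow n q h) <= INR n * r ^ n * Hnorm h.
Proof.
intros Hr Hq; induction n as [|n IH]; [simpl; rewrite Hnorm_zero; lra|].
change (dpow (S n) q h) with (plus (mult h (pow_n (q : H_Ring) n)) (mult q (dpow n q h))).
apply Rle_trans with (1 := Hnorm_triangle _ _); rewrite !Hnorm_mult.
refine (Rle_trans _ _ _ _ (pow_step r _ _ n Hr (Hnorm_ge_0 h) IH)).
apply Rplus_le_compat.
- apply Rmult_le_compat_l; [apply Hnorm_ge_0|now apply pow_bound].
- apply Rmult_le_compat_r; [apply Hnorm_ge_0|assumption].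
Qed.

Lemma pow_incr_S (q h : H) n : pow_incr_H q h (S n) =
  plus (mult h (pow_n (plus q h : H_Ring) n)) (mult q (pow_incr_H q h n)).
Proof.
unfold pow_incr_H; simpl; generalize (pow_n (plus q h : H_Ring) n : H) (pow_n (q : H_Ring) n : H);
Hring.
Qed.

Lemma pow_incr_bound (q h : H) (r : R) n : 1 <= r -> Hnorm q <= r -> Hnorm (plus q h) <= r ->
  Hnorm (pow_incr_H q h n) <= INR n * r ^ n * Hnorm h.
Proof.
intros Hr Hq Hqh; induction n as [|n IH].
- replace (pow_incr_H q h 0) with (zero : H); [rewrite Hnorm_zero; simpl; lra|].
  unfold pow_incr_H; simpl; clear; Hring.
- rewrite pow_incr_S; apply Rle_trans with (1 := Hnorm_triangle _ _); rewrite !Hnorm_mult.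
  refine (Rle_trans _ _ _ _ (pow_step r _ _ n Hr (Hnorm_ge_0 h) IH)).
  apply Rplus_le_compat.
  + apply Rmult_le_compat_l; [apply Hnorm_ge_0|now apply pow_bound].
  + apply Rmult_le_compat_r; [apply Hnorm_ge_0|assumption].
Qed.

Lemma pow_remainder_S (q h : H) n : minus (pow_incr_H q h (S n)) (dpow (S n) q h) =
  plus (mult h (pow_incr_H q h n)) (mult q (minus (pow_incr_H q h n) (dpow n q h))).
Proof.
unfold pow_incr_H; simpl.
generalize (pow_n (plus q h : H_Ring) n : H) (pow_n (q : H_Ring) n : H) (dpow n q h); Hring.
Qed.

(** The recursion adds [h] times a first-order increment at each step. The square of [n] is
    generous: with [1 <= r] the induction only needs [n + n^2 <= (n + 1)^2]. *)
Lemma pow_remainder_bound (q h : H) (r : R) n : 1 <= r -> Hnorm q <= r -> Hnorm (plus q h) <= r ->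
  Hnorm (minus (pow_incr_H q h n) (dpow n q h)) <= (INR n * INR n) * r ^ n * (Hnorm h * Hnorm h).
Proof.
intros Hr Hq Hqh; assert (Hh := Hnorm_ge_0 h); induction n as [|n IH].
- replace (minus (pow_incr_H q h 0) (dpow 0 q h)) with (zero : H); [rewrite Hnorm_zero; simpl;
  lra|].
  unfold pow_incr_H; simpl; clear; Hring.
- rewrite pow_remainder_S; apply Rle_trans with (1 := Hnorm_triangle _ _); rewrite !Hnorm_mult.
  assert (Hp := pow_incr_bound q h r n Hr Hq Hqh); assert (Hn := pos_INR n).
  assert (Hrn : 1 <= r ^ n) by now apply pow_R1_Rle.
  rewrite S_INR -tech_pow_Rmult.
  apply Rle_trans with (Hnorm h * (INR n * r ^ n * Hnorm h) + r * (INR n * INR n * r ^ n * (Hnorm h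
    * Hnorm h))).
  + apply Rplus_le_compat; [now apply Rmult_le_compat_l|].
    apply Rmult_le_compat; try assumption; apply Hnorm_ge_0.
  + set (K := r ^ n * (Hnorm h * Hnorm h)).
    assert (HK : 0 <= K) by (apply Rmult_le_pos; [lra|nra]).
    assert (HK' : K <= r * K) by nra.
    assert (0 <= INR n * (r * K - K)) by (apply Rmult_le_pos; lra).
    assert (0 <= INR n * (r * K)) by (apply Rmult_le_pos; lra).
    replace (Hnorm h * (INR n * r ^ n * Hnorm h) + r * (INR n * INR n * r ^ n * (Hnorm h * Hnorm
      h)))
      with (INR n * K + INR n * INR n * (r * K)) by (unfold K; ring).
    replace ((INR n + 1) * (INR n + 1) * (r * r ^ n) * (Hnorm h * Hnorm h))
      with (INR n * INR n * (r * K) + 2 * (INR n * (r * K)) + r * K) by (unfold K; ring).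
    lra.
Qed.


Lemma INR_le_pow2 n : INR n <= 2 ^ n.
Proof.
induction n as [|n IH]; [simpl; lra|].
rewrite S_INR -tech_pow_Rmult; assert (H1 : 1 <= 2 ^ n) by (apply pow_R1_Rle; lra); lra.
Qed.

(** Infinite radius of convergence, in a form that the real axis alone can supply. *)
Definition entire_growth (a : nat -> H) : Prop :=
  forall r, 0 < r -> exists M, forall n, Hnorm (a n) * r ^ n <= M.

Section PowerSeries.

Variable a : nat -> H.
Hypothesis a_growth : entire_growth a.

(** One majorant for three uses: the summand 1 for the series itself, [INR n] for its termwise
    differential, [INR n * INR n] for the second-order remainder. *)
Lemma dominated_terms (r : R) : 1 <= r -> exists M, 0 <= M /\
  forall n, (INR n * INR n + INR n + 1) * r ^ n * Hnorm (a n) <= M * (1 / 2) ^ n.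
Proof.
intros Hr.
(* By [INR n <= 2 ^ n] the polynomial factor is at most [3 * 4 ^ n]. Of the three factors 2 in 8,
   two absorb this power and the third leaves the geometric ratio. *)
destruct (a_growth (8 * r)) as [M HM]; [lra|].
assert (HM0 : 0 <= M).
{ apply Rle_trans with (2 := HM 0%nat); simpl; assert (H0 := Hnorm_ge_0 (a 0%nat)); lra. }
exists (3 * M); split; [lra|]; intros n.
assert (Hn := INR_le_pow2 n); assert (Hn0 := pos_INR n).
assert (H1 : 1 <= 2 ^ n) by (apply pow_R1_Rle; lra).
assert (Hrn : 0 < r ^ n) by (apply pow_lt; lra).
assert (Ha := Hnorm_ge_0 (a n)).
assert (E : 3 * M * (1 / 2) ^ n = 3 * (M * (/ 2) ^ n)).
{ unfold Rdiv; rewrite Rmult_1_l; ring. }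
rewrite E.
apply Rle_trans with ((3 * (2 ^ n * 2 ^ n)) * r ^ n * Hnorm (a n)).
- repeat (apply Rmult_le_compat_r; [lra|]); nra.
- replace (3 * (2 ^ n * 2 ^ n) * r ^ n * Hnorm (a n)) with (3 * ((Hnorm (a n) * (8 * r) ^ n) * (/
    2) ^ n)).
  + apply Rmult_le_compat_l; [lra|]; apply Rmult_le_compat_r; [|apply HM].
    apply pow_le; lra.
  + rewrite Rpow_mult_distr pow_inv.
    replace 8 with (2 * 2 * 2) by ring; rewrite !Rpow_mult_distr; field; lra.
Qed.

Lemma power_series_exists : exists f, is_power_series f a.
Proof.
exists (fun q => Hseries (fun n => mult (pow_n (q : H_Ring) n) (a n))).
intros q; set (r := Hnorm q + 1).
assert (Hq := Hnorm_ge_0 q).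
destruct (dominated_terms r) as [M [_ HM]]; [unfold r; lra|].
destruct (H_series_geometric (fun n => mult (pow_n (q : H_Ring) n) (a n)) M) as [s [Hs _]].
- intros n; apply Rle_trans with (2 := HM n); rewrite Hnorm_mult.
  apply Rmult_le_compat_r; [apply Hnorm_ge_0|].
  assert (Hn0 := pos_INR n).
  apply Rle_trans with (r ^ n); [apply pow_bound; unfold r; lra|].
  assert (0 < r ^ n) by (apply pow_lt; unfold r; lra).
  rewrite -{1}(Rmult_1_l (r ^ n)); apply Rmult_le_compat_r; [lra|nra].
- now rewrite (HseriesE _ _ Hs).
Qed.

Definition pseries_diff (q h : H) : H := Hseries (fun n => mult (dpow n q h) (a n)).

Lemma pseries_diff_bound q : exists M, 0 <= M /\ forall h,
  H_series (fun n => mult (dpow n q h) (a n)) (pseries_diff q h) /\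
  Hnorm (pseries_diff q h) <= M * Hnorm h.
Proof.
set (r := Hnorm q + 1).
assert (Hq := Hnorm_ge_0 q).
destruct (dominated_terms r) as [M [HM0 HM]]; [unfold r; lra|].
exists (2 * M); split; [lra|]; intros h; assert (Hh := Hnorm_ge_0 h).
destruct (H_series_geometric (fun n => mult (dpow n q h) (a n)) (M * Hnorm h)) as [s [Hs Hb]].
- intros n; rewrite Hnorm_mult.
  replace (M * Hnorm h * (1 / 2) ^ n) with ((M * (1 / 2) ^ n) * Hnorm h) by ring.
  apply Rle_trans with ((INR n * INR n + INR n + 1) * r ^ n * Hnorm (a n) * Hnorm h).
  + assert (Hn0 := pos_INR n); assert (Ha := Hnorm_ge_0 (a n)).
    apply Rle_trans with ((INR n * r ^ n * Hnorm h) * Hnorm (a n)).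
    * apply Rmult_le_compat_r; [assumption|apply dpow_bound; unfold r; lra].
    * assert (0 < r ^ n) by (apply pow_lt; unfold r; lra).
      assert (0 <= r ^ n * Hnorm (a n) * Hnorm h) by (repeat apply Rmult_le_pos; lra).
      nra.
  + apply Rmult_le_compat_r; [assumption|apply HM].
- unfold pseries_diff; rewrite (HseriesE _ _ Hs); split; [assumption|lra].
Qed.

Lemma pseries_diff_series q h : H_series (fun n => mult (dpow n q h) (a n)) (pseries_diff q h).
Proof. destruct (pseries_diff_bound q) as [M [_ HM]]; apply HM. Qed.

Lemma is_linear_pseries_diff q :
  is_linear (U := H_NormedModule) (V := H_NormedModule) (pseries_diff q).
Proof.
split.
- intros h h'; apply (H_series_limit_unique _ _ _ (pseries_diff_series q (plus h h'))).
  apply (is_series_ext (V := H_NormedModule)) with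
    (2 := H_series_plus _ _ _ _ (pseries_diff_series q h) (pseries_diff_series q h')).
  intros n; rewrite dpow_plus; generalize (dpow n q h) (dpow n q h') (a n); clear; Hring.
- intros x h; apply (H_series_limit_unique _ _ _ (pseries_diff_series q (scal x h))).
  apply (is_series_ext (V := H_NormedModule)) with (2 := H_series_scal x _ _ (pseries_diff_series q
    h)).
  intros n; rewrite dpow_scal; generalize (dpow n q h) (a n); revert x; clear; Hring.
- destruct (pseries_diff_bound q) as [M [HM0 HM]].
  exists (M + 1); split; [lra|]; intros h.
  change (Hnorm (pseries_diff q h) <= (M + 1) * Hnorm h).
  destruct (HM h) as [_ Hh]; assert (Hh0 := Hnorm_ge_0 h); lra.
Qed.

Lemma pseries_diff_commute q h :
  mult q h = mult h q -> pseries_diff q h = mult h (pseries_diff q one).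
Proof.
intros E; apply (H_series_limit_unique _ _ _ (pseries_diff_series q h)).
apply (is_series_ext (V := H_NormedModule)) with (2 := H_series_mult_l h _ _ (pseries_diff_series q
  one)).
intros n; rewrite (dpow_commute n q h E); apply (mult_assoc (K := H_Ring)).
Qed.

Variable f : H -> H.
Hypothesis f_series : is_power_series f a.

Lemma power_series_H_diff q : H_diff f q (pseries_diff q).
Proof.
(* This radius bounds [q] as well as [plus q h] for every increment of norm less than 1. *)
set (r := Hnorm q + 1); assert (Hq := Hnorm_ge_0 q).
destruct (dominated_terms r) as [M [HM0 HM]]; [unfold r; lra|].
intros eps Heps.
(* The remainder series is at most [2 * M * Hnorm h * Hnorm h]; the added 1 allows [M = 0]. *)
exists (Rmin 1 (eps / (2 * M + 1))); split.
{ apply Rmin_pos; [lra|apply Rdiv_lt_0_compat; lra]. }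
intros p Hp; set (h := minus p q) in *.
assert (Ep : p = plus q h) by (unfold h; generalize p q; clear; Hring).
assert (Hp1 := Rlt_le_trans _ _ _ Hp (Rmin_l _ _)).
assert (Hp2 := Rlt_le_trans _ _ _ Hp (Rmin_r _ _)).
assert (Hh := Hnorm_ge_0 h).
assert (HS := H_series_plus _ _ _ _ (f_series p)
  (H_series_opp _ _ (H_series_plus _ _ _ _ (f_series q) (pseries_diff_series q h)))).
destruct (H_series_geometric (fun n => mult (minus (pow_incr_H q h n) (dpow n q h)) (a n))
  (M * (Hnorm h * Hnorm h))) as [s [Hs Hb]].
- intros n; rewrite Hnorm_mult.
  replace (M * (Hnorm h * Hnorm h) * (1 / 2) ^ n) with ((M * (1 / 2) ^ n) * (Hnorm h * Hnorm h)) by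
    ring.
  apply Rle_trans with ((INR n * INR n + INR n + 1) * r ^ n * Hnorm (a n) * (Hnorm h * Hnorm h)).
  + assert (Hn0 := pos_INR n); assert (Ha := Hnorm_ge_0 (a n)).
    apply Rle_trans with ((INR n * INR n * r ^ n * (Hnorm h * Hnorm h)) * Hnorm (a n)).
    * apply Rmult_le_compat_r; [assumption|].
      apply (pow_remainder_bound q h r); unfold r; [lra|lra|].
      apply Rle_trans with (1 := Hnorm_triangle _ _); lra.
    * assert (0 < r ^ n) by (apply pow_lt; unfold r; lra).
      assert (0 <= r ^ n * Hnorm (a n) * (Hnorm h * Hnorm h)) by (repeat apply Rmult_le_pos; lra).
      nra.
  + apply Rmult_le_compat_r; [nra|apply HM].
- replace (minus (minus (f p) (f q)) (pseries_diff q h)) with s.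
  + apply Rle_trans with (1 := Hb).
    replace (2 * (M * (Hnorm h * Hnorm h))) with ((2 * M * Hnorm h) * Hnorm h) by ring.
    apply Rmult_le_compat_r; [assumption|].
    apply (Rmult_lt_compat_r (2 * M + 1)) in Hp2; [|lra].
    replace (eps / (2 * M + 1) * (2 * M + 1)) with eps in Hp2 by (field; lra).
    nra.
  + transitivity (plus (f p) (opp (plus (f q) (pseries_diff q h))) : H).
    * apply (H_series_limit_unique _ _ _ Hs).
      apply (is_series_ext (V := H_NormedModule)) with (2 := HS); intros n.
      unfold pow_incr_H; rewrite -Ep.
      generalize (pow_n (p : H_Ring) n : H) (pow_n (q : H_Ring) n : H) (dpow n q h) (a n); clear;
      Hring.
    * generalize (f p) (f q) (pseries_diff q h); clear; Hring.
Qed.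

Lemma power_series_slice_regular : slice_regular f.
Proof.
split.
- intros q; exists (pseries_diff q); apply H_diffP; split.
  + apply is_linear_pseries_diff.
  + apply power_series_H_diff.
- intros I x y; set (q := slice I x y).
  exists (pseries_diff q one), (pseries_diff q (I : H)); split; [|split].
  + apply R_diffP, (H_diff_line f q).
    * apply is_linear_pseries_diff.
    * apply power_series_H_diff.
    * exact Hnorm_one.
    * intros t; unfold q; generalize (Sph_val I) x y; clear; Hring.
  + apply R_diffP, (H_diff_line f q).
    * apply is_linear_pseries_diff.
    * apply power_series_H_diff.
    * apply Sph_norm.
    * intros t; unfold q; generalize (Sph_val I) x y; clear; Hring.
  + rewrite (pseries_diff_commute q (I : H)).
    * rewrite (mult_assoc (K := H_Ring)) Sph_sqr; generalize (pseries_diff q one); clear; Hring.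
    * unfold q; generalize (Sph_val I) x y; clear; Hring.
Qed.

End PowerSeries.

(** * The splitting and its matrix *)

Lemma C_diff_plus f g z l m : C_diff f z l -> C_diff g z m -> C_diff (fun z => f z + g z)%C z (l +
  m).
Proof.
rewrite -!C_diff_absP; exact (is_derive_plus (K := C_AbsRing) (V := AbsRing_NormedModule C_AbsRing)
  f g z l m).
Qed.

Lemma C_diff_mult f g z l m :
  C_diff f z l -> C_diff g z m -> C_diff (fun z => f z * g z)%C z (l * g z + f z * m).
Proof.
rewrite -!C_diff_absP; intros Hf Hg.
exact (is_derive_mult (K := C_AbsRing) f g z l m Hf Hg Cmult_comm).
Qed.

Lemma C_diff_const c z : C_diff (fun _ => c) z 0.
Proof. rewrite -C_diff_absP; exact (is_derive_const (K := C_AbsRing) (V := AbsRing_NormedModule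
  C_AbsRing) c z). Qed.

(** Each of the two conjugations makes the differential antilinear, so together they leave it
    complex linear, with coefficient [Cconj l]. *)
Lemma C_diff_conj f z l : C_diff f (Cconj z) l -> C_diff (fun z => Cconj (f (Cconj z))) z (Cconj l).
Proof.
intros Hf eps Heps; destruct (Hf eps Heps) as [d [Hd Hb]]; exists d; split; [assumption|].
assert (Em : forall y, Cmod (Cconj y - Cconj z) = Cmod (y - z)).
{ intros y; rewrite -(Cmod_conj (y - z)); f_equal; destruct y, z.
  unfold Cconj, Cminus, Cplus, Copp; simpl; f_equal; ring. }
intros y Hy; specialize (Hb (Cconj y)); rewrite Em in Hb; specialize (Hb Hy).
rewrite -Cmod_conj in Hb; apply Rle_trans with (2 := Hb); apply Req_le; f_equal.
destruct (f (Cconj y)), (f (Cconj z)), y, z, l.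
unfold Cconj, Cminus, Cplus, Copp, Cmult; simpl; f_equal; ring.
Qed.

Section Entire.

Variable I : Sph.

(** [entire] with its witness named, so that computations with components take place in the field
    [C]. *)
Definition represents (F : CI I -> H) (phi : C -> C) : Prop :=
  (forall z, exists l, C_diff phi z l) /\ forall z, F (CI_of_C I z) = emb I (phi z).

Lemma entireP F : entire I F <-> exists phi, represents F phi.
Proof.
split; intros [phi [Hd HF]]; exists phi; split; try assumption.
- intros z; destruct (Hd z) as [l Hl]; exists l; now apply C_diffP.
- intros z; destruct (Hd z) as [l Hl]; exists l; now apply C_diffP.
Qed.

Lemma CI_eq (z w : CI I) : CI_val I z = CI_val I w -> z = w.
Proof.
destruct z as [z Hz], w as [w Hw]; simpl; intros E; subst w.
f_equal; apply Classical_Prop.proof_irrelevance.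
Qed.

Lemma CI_surj (z : CI I) : exists c, z = CI_of_C I c.
Proof. destruct z as [z (x & y & ->)]; exists (x, y); now apply CI_eq. Qed.

Lemma CI_conj_of_C (c : C) : CI_conj (CI_of_C I c) = CI_of_C I (Cconj c).
Proof. apply CI_eq; exact (emb_conj I c). Qed.

Lemma CI_ext (T : Type) (F G : CI I -> T) : (forall c, F (CI_of_C I c) = G (CI_of_C I c)) -> F = G.
Proof. intros E; apply functional_extensionality; intros z; destruct (CI_surj z) as [c ->];
apply E. Qed.

Lemma represents_plus F G phi psi : represents F phi -> represents G psi ->
  represents (fun z => plus (F z) (G z)) (fun z => phi z + psi z)%C.
Proof.
intros [Hp HF] [Hq HG]; split.
- intros z; destruct (Hp z) as [l Hl], (Hq z) as [m Hm]; eexists; apply C_diff_plus; eassumption.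
- intros z; rewrite HF HG; symmetry; apply emb_plus.
Qed.

Lemma represents_mult F G phi psi : represents F phi -> represents G psi ->
  represents (fun z => mult (F z) (G z)) (fun z => phi z * psi z)%C.
Proof.
intros [Hp HF] [Hq HG]; split.
- intros z; destruct (Hp z) as [l Hl], (Hq z) as [m Hm]; eexists; apply C_diff_mult; eassumption.
- intros z; rewrite HF HG; symmetry; apply emb_mult.
Qed.

Lemma represents_scal x F phi : represents F phi ->
  represents (fun z => scal x (F z)) (fun z => RtoC x * phi z)%C.
Proof.
intros [Hp HF]; split.
- intros z; destruct (Hp z) as [l Hl]; eexists; apply C_diff_mult; [apply C_diff_const|eassumption].
- intros z; rewrite HF emb_mult emb_RtoC; symmetry; apply RtoH_scal.
Qed.

Lemma represents_opp F phi : represents F phi ->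
  represents (fun z => opp (F z)) (fun z => - RtoC 1 * phi z)%C.
Proof.
intros [Hp HF]; split.
- intros z; destruct (Hp z) as [l Hl]; eexists; apply C_diff_mult; [apply C_diff_const|eassumption].
- intros z; rewrite HF -emb_opp; f_equal; ring.
Qed.

Lemma represents_sharp F phi : represents F phi ->
  represents (sharp F) (fun z => Cconj (phi (Cconj z))).
Proof.
intros [Hp HF]; split.
- intros z; destruct (Hp (Cconj z)) as [l Hl]; eexists; apply C_diff_conj; eassumption.
- intros z; unfold sharp; rewrite CI_conj_of_C HF; apply emb_conj.
Qed.

End Entire.

Section Phi.

Variables I J : Sph.
Hypothesis I_orth_J : orthogonal I J.

Lemma splits_sp f F G phi psi : represents I F phi -> represents I G psi ->
  (splits I J f F G <-> forall c, f (emb I c) = sp I J (phi c) (psi c)).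
Proof.
intros HF HG; split.
- intros (_ & _ & Hf) c; rewrite -embE Hf (proj2 HF) (proj2 HG); reflexivity.
- intros Hf; split; [|split].
  + apply entireP; now exists phi.
  + apply entireP; now exists psi.
  + intros z; destruct (CI_surj I z) as [c ->]; rewrite embE Hf (proj2 HF) (proj2 HG); reflexivity.
Qed.

Lemma splits_unique f F G F' G' : splits I J f F G -> splits I J f F' G' -> F = F' /\ G = G'.
Proof.
intros HS HS'.
destruct (proj1 (entireP I F) (proj1 HS)) as [p Hp], (proj1 (entireP I G) (proj1 (proj2 HS))) as [q
  Hq].
destruct (proj1 (entireP I F') (proj1 HS')) as [p' Hp'], (proj1 (entireP I G') (proj1 (proj2 HS')))
  as [q' Hq'].
assert (E1 := proj1 (splits_sp f F G p q Hp Hq) HS);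
assert (E2 := proj1 (splits_sp f F' G' p' q' Hp' Hq') HS').
assert (E : forall c, p c = p' c /\ q c = q' c).
{ intros c; apply (sp_inj I J I_orth_J); now rewrite -E1 -E2. }
split; apply CI_ext; intros c.
- rewrite (proj2 Hp) (proj2 Hp'); f_equal; apply E.
- rewrite (proj2 Hq) (proj2 Hq'); f_equal; apply E.
Qed.

(** Because splittings are unique, the one chosen inside [Phi] may be replaced by any splitting at
    hand. *)
Lemma PhiE f F G : splits I J f F G -> Phi I J f = sharp_matrix F G.
Proof.
intros HS.
assert (HE : splits I J f (fst (splitting I J f)) (snd (splitting I J f))).
{ apply (epsilon_spec (inhabits (fun _ : CI I => zero, fun _ : CI I => zero))
    (fun FG => splits I J f (fst FG) (snd FG))); now exists (F, G). }
destruct (splits_unique _ _ _ _ _ HS HE) as [-> ->].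
unfold Phi; now destruct (splitting I J f).
Qed.

Lemma slice_regular_splits f : slice_regular f -> exists F G phi psi,
  represents I F phi /\ represents I G psi /\ forall c, f (emb I c) = sp I J (phi c) (psi c).
Proof.
intros Hf; destruct (slice_regular_C_diff I J I_orth_J f Hf) as [HF HG].
exists (fun z => emb I (fst_part I J (f z))), (fun z => emb I (snd_part I J (f z))).
exists (fun z => fst_part I J (f (emb I z))), (fun z => snd_part I J (f (emb I z))).
split; [now split|split; [now split|]].
intros c; symmetry; now apply spK.
Qed.

Lemma slice_regular_ext f g : slice_regular f -> slice_regular g ->
  (forall x, f (RtoH x) = g (RtoH x)) -> f = g.
Proof.
intros Hf Hg E.
destruct (slice_regular_power_series f Hf) as [a Ha], (slice_regular_power_series g Hg) as [b Hb].
assert (Eab : a = b).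
{ apply (H_series_unique _ _ (fun x => f (RtoH x))); intros x; [apply Ha|rewrite E; apply Hb]. }
apply functional_extensionality; intros q; subst b.
exact (H_series_limit_unique _ _ _ (Ha q) (Hb q)).
Qed.

(** Each term is a difference of consecutive partial sums, which are bounded; at the real point [r]
    the norm of the term is [Hnorm (a n) * r ^ n]. *)
Lemma power_series_growth (a : nat -> H) :
  (forall x, exists l, H_series (fun n => mult (pow_n (RtoH x : H_Ring) n) (a n)) l) ->
    entire_growth a.
Proof.
intros Ha r Hr; destruct (Ha r) as [l Hl].
set (u := fun n => mult (pow_n (RtoH r : H_Ring) n) (a n)) in Hl.
destruct (filterlim_bounded (V := H_NormedModule) (sum_n u)) as [M HM]; [now exists l|].
assert (HM' : forall n, Hnorm (sum_n u n) <= M) by exact HM.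
assert (HM0 : 0 <= M) by (apply Rle_trans with (2 := HM' 0%nat); apply Hnorm_ge_0).
exists (2 * M); intros n.
assert (E : Hnorm (a n) * r ^ n = Hnorm (u n)).
{ unfold u; rewrite Hnorm_mult pow_n_RtoH.
  rewrite Hnorm_RtoH Rabs_pos_eq; [ring|apply pow_le; lra]. }
rewrite E; destruct n as [|n].
- specialize (HM' 0%nat); rewrite sum_O in HM'; lra.
- replace (u (S n)) with (plus (sum_n u (S n)) (opp (sum_n u n)) : H).
  + apply Rle_trans with (1 := Hnorm_triangle _ _); rewrite Hnorm_opp.
    assert (H1 := HM' n); assert (H2 := HM' (S n)); lra.
  + rewrite sum_Sn; change (plus (plus (sum_n u n : H) (u (S n))) (opp (sum_n u n)) = u (S n)).
    generalize (sum_n u n : H) (u (S n)); clear; Hring.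
Qed.

(** The Taylor series of [phi] and [psi] only give convergence on [C_I]. The growth of the combined
    coefficients, read on the real axis, carries the series over to all of [H]. *)
Lemma splits_surj (U V : CI I -> H) (phi psi : C -> C) :
  represents I U phi -> represents I V psi ->
  exists f, slice_regular f /\ forall c, f (emb I c) = sp I J (phi c) (psi c).
Proof.
intros [HU EU] [HV EV].
destruct (taylor phi HU) as [u Hu], (taylor psi HV) as [v Hv].
set (a := fun n => sp I J (u n) (v n)).
assert (Ha : forall z, H_series (fun n => mult (pow_n (emb I z : H_Ring) n) (a n)) (sp I J (phi z)
  (psi z))).
{ intros z; exact (is_series_sp I J I_orth_J u v z _ _ (Hu z) (Hv z)). }
assert (Hg : entire_growth a).
{ apply power_series_growth; intros x; exists (sp I J (phi x) (psi x)); rewrite -(emb_RtoC I);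
  apply Ha. }
destruct (power_series_exists a Hg) as [f Hf].
exists f; split; [exact (power_series_slice_regular a Hg f Hf)|].
intros c; exact (H_series_limit_unique _ _ _ (Hf (emb I c)) (Ha c)).
Qed.

Lemma emb_J z : mult (J : H) (emb I z) = mult (emb I (Cconj z)) (J : H).
Proof.
assert (E := orthogonal_anticommute I J I_orth_J).
destruct z as [x y]; unfold emb, slice, Cconj; simpl.
transitivity (plus (scal x (J : H)) (scal y (mult (J : H) (I : H))) : H).
- generalize (Sph_val I) (Sph_val J); clear; Hring.
- rewrite E; generalize (Sph_val I) (Sph_val J); clear; Hring.
Qed.

(** The conjugates arise from moving [J] past elements of [C_I]. The result is the first row of the
    product of the matrices that represent the two quaternions. *)
Lemma sp_mult z w z' w' :
  mult (sp I J z w) (sp I J z' w') = sp I J (z * z' - w * Cconj w') (z * w' + w * Cconj z').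
Proof.
unfold sp, Cminus; rewrite !emb_plus emb_opp !emb_mult.
transitivity (plus (plus (mult (emb I z) (emb I z')) (mult (mult (emb I z) (emb I w')) (J : H)))
  (plus (mult (emb I w) (mult (J : H) (emb I z'))) (mult (emb I w) (mult (mult (J : H) (emb I w'))
    (J : H)))) : H).
{ generalize (emb I z) (emb I w) (emb I z') (emb I w') (Sph_val J); clear; Hring. }
rewrite !emb_J.
transitivity (plus (plus (mult (emb I z) (emb I z')) (mult (mult (emb I z) (emb I w')) (J : H)))
  (plus (mult (mult (emb I w) (emb I (Cconj z'))) (J : H)) (mult (mult (emb I w) (emb I (Cconj
    w'))) (mult (J : H) (J : H)))) : H).
{ generalize (emb I z) (emb I w) (emb I z') (emb I w') (emb I (Cconj z')) (emb I (Cconj w'))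
    (Sph_val J); clear; Hring. }
rewrite Sph_sqr.
generalize (emb I z) (emb I w) (emb I z') (emb I w') (emb I (Cconj z')) (emb I (Cconj w')) (Sph_val
  J); clear; Hring.
Qed.

End Phi.

(** * The star product *)

Definition conv (a b : nat -> H) (n : nat) : H :=
  sum_n (fun k => mult (a k) (b (n - k)%nat)) n.

(** Cauchy's product at one real point, as a relation additive in each factor; this lets the
    quaternionic product be assembled from products of real power series. *)
Definition cauchy_at (x : R) (a b : nat -> H) (l m : H) : Prop :=
  H_series (fun n => scal (x ^ n) (conv a b n)) (mult l m).

Lemma cauchy_at_plus_l x a a' b l l' m : cauchy_at x a b l m -> cauchy_at x a' b l' m ->
  cauchy_at x (fun n => plus (a n) (a' n)) b (plus l l') m.
Proof.
intros Ha Ha'; unfold cauchy_at.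
rewrite (mult_distr_r (K := H_Ring)).
apply (is_series_ext (V := H_NormedModule)) with (2 := H_series_plus _ _ _ _ Ha Ha').
intros n; rewrite -(scal_distr_l (V := H_ModuleSpace)); f_equal.
unfold conv; rewrite -(sum_n_plus (G := H_AbelianMonoid)).
apply sum_n_ext; intros k; symmetry; apply (mult_distr_r (K := H_Ring)).
Qed.

Lemma cauchy_at_plus_r x a b b' l m m' : cauchy_at x a b l m -> cauchy_at x a b' l m' ->
  cauchy_at x a (fun n => plus (b n) (b' n)) l (plus m m').
Proof.
intros Hb Hb'; unfold cauchy_at.
rewrite (mult_distr_l (K := H_Ring)).
apply (is_series_ext (V := H_NormedModule)) with (2 := H_series_plus _ _ _ _ Hb Hb').
intros n; rewrite -(scal_distr_l (V := H_ModuleSpace)); f_equal.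
unfold conv; rewrite -(sum_n_plus (G := H_AbelianMonoid)).
apply sum_n_ext; intros k; symmetry; apply (mult_distr_l (K := H_Ring)).
Qed.

Lemma sum_n_scal_H (u : nat -> R) (e : H) n :
  sum_n (fun k => scal (u k) e) n = scal (sum_n u n) e.
Proof.
induction n as [|n IH]; [now rewrite !sum_O|].
rewrite !sum_Sn IH; symmetry; apply (scal_distr_r (V := H_ModuleSpace)).
Qed.

Lemma cauchy_at_scal x (al be : nat -> R) (A B : R) (p q : H) :
  is_pseries al x A -> is_pseries be x B ->
  Rbar_lt (Rabs x) (CV_radius al) -> Rbar_lt (Rabs x) (CV_radius be) ->
  cauchy_at x (fun n => scal (al n) p) (fun n => scal (be n) q) (scal A p) (scal B q).
Proof.
intros HA HB CA CB.
assert (HS := is_series_linear _ _ _ (is_linear_scal_H (mult p q)) (is_pseries_mult _ _ _ _ _ HA HB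
  CA CB)).
unfold cauchy_at; rewrite Hmult_scal_l Hmult_scal_r (scal_assoc (V := H_ModuleSpace)).
apply (is_series_ext (V := H_NormedModule)) with (2 := HS); intros n.
rewrite pow_n_pow -(scal_assoc (V := H_ModuleSpace)); f_equal.
unfold conv; rewrite (sum_n_ext _ (fun k => scal (al k * be (n - k)%nat) (mult p q))).
- rewrite (sum_n_scal_H (fun k => al k * be (n - k)%nat)); f_equal; unfold PS_mult; symmetry;
  apply sum_n_Reals.
- intros k; rewrite Hmult_scal_l Hmult_scal_r; apply (scal_assoc (V := H_ModuleSpace)).
Qed.

Lemma H_coord_decomposition (q : H) : q =
  plus (plus (scal (H_coord 0 q) (1, 0, 0, 0)) (scal (H_coord 1 q) (0, 1, 0, 0)))
       (plus (scal (H_coord 2 q) (0, 0, 1, 0)) (scal (H_coord 3 q) (0, 0, 0, 1))) :> H.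
Proof. Hring. Qed.

(** Convergence at [Rabs x + 1] provides the strict inequality that the product of real power series
    requires. *)
Lemma H_coord_CV_radius (a : nat -> H) (F : R -> H) i x :
  (forall y, H_series (fun n => mult (pow_n (RtoH y : H_Ring) n) (a n)) (F y)) ->
  Rbar_lt (Rabs x) (CV_radius (fun n => H_coord i (a n))).
Proof.
intros Ha.
assert (Hx := Rabs_pos x).
apply Rbar_lt_le_trans with (Finite (Rabs (Rabs x + 1))).
- simpl; rewrite (Rabs_pos_eq (Rabs x + 1)); lra.
- apply ex_pseries_CV_radius; eexists; apply is_pseries_H_coord, Ha.
Qed.

Lemma cauchy_product (a b : nat -> H) (F G : R -> H) x :
  (forall y, H_series (fun n => mult (pow_n (RtoH y : H_Ring) n) (a n)) (F y)) ->
  (forall y, H_series (fun n => mult (pow_n (RtoH y : H_Ring) n) (b n)) (G y)) ->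
  H_series (fun n => mult (pow_n (RtoH x : H_Ring) n) (conv a b n)) (mult (F x) (G x)).
Proof.
intros Ha Hb.
assert (HC : cauchy_at x a b (F x) (G x)).
{ rewrite (H_coord_decomposition (F x)) (H_coord_decomposition (G x)).
  rewrite (functional_extensionality a _ (fun n => H_coord_decomposition (a n))).
  rewrite (functional_extensionality b _ (fun n => H_coord_decomposition (b n))).
  (* Along the basis of four units there are sixteen pairs, each a product of two real power series
     times a constant quaternion. *)
  apply cauchy_at_plus_l; apply cauchy_at_plus_l; apply cauchy_at_plus_r; apply cauchy_at_plus_r;
  (apply cauchy_at_scal; [apply is_pseries_H_coord, Ha|apply is_pseries_H_coord, Hb
    |apply (H_coord_CV_radius a F), Ha|apply (H_coord_CV_radius b G), Hb]). }
apply (is_series_ext (V := H_NormedModule)) with (2 := HC).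
intros n; now rewrite pow_n_RtoH RtoH_scal.
Qed.

(** * Matrices and real linearity *)

Lemma mat2_plus a b c d a' b' c' d' :
  plus (mat2 a b c d) (mat2 a' b' c' d') = mat2 (plus a a') (plus b b') (plus c c') (plus d d').
Proof. reflexivity. Qed.

Lemma mat2_scal x a b c d : Rscal_mat x (mat2 a b c d) = mat2 (scal x a) (scal x b) (scal x c)
  (scal x d).
Proof. reflexivity. Qed.

Lemma mat2_mult (a b c d a' b' c' d' : H) :
  Mmult (mat2 a b c d) (mat2 a' b' c' d') =
  mat2 (plus (mult a a') (mult b c')) (plus (mult a b') (mult b d'))
       (plus (mult c a') (mult d c')) (plus (mult c b') (mult d d')).
Proof.
assert (E : forall u : nat -> H, sum_n u 1 = plus (u 0%nat) (u 1%nat)).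
{ intros u; now rewrite sum_Sn sum_O. }
apply mk_matrix_ext; intros i j Hi Hj.
destruct i as [|[|i]]; [| |lia]; destruct j as [|[|j]]; try lia; rewrite E; reflexivity.
Qed.

Lemma mat2_inj (a b c d a' b' c' d' : H) :
  mat2 a b c d = mat2 a' b' c' d' -> a = a' /\ b = b'.
Proof.
intros E; split.
- exact (f_equal (fun A => coeff_mat (zero : H) A 0 0) E).
- exact (f_equal (fun A => coeff_mat (zero : H) A 0 1) E).
Qed.

Lemma slice_regular_plus (f g : H -> H) :
  slice_regular f -> slice_regular g -> slice_regular (fun q => plus (f q) (g q)).
Proof.
intros [Df Rf] [Dg Rg]; split.
- intros q; destruct (Df q) as [L HL], (Dg q) as [M HM]; eexists.
  exact (filterdiff_plus_fct (U := H_NormedModule) (V := H_NormedModule) f g L M HL HM).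
- intros I x y.
  destruct (Rf I x y) as (fx & fy & Hfx & Hfy & Ef), (Rg I x y) as (gx & gy & Hgx & Hgy & Eg).
  exists (plus fx gx), (plus fy gy); split; [|split].
  + exact (is_derive_plus (V := H_NormedModule) _ _ _ _ _ Hfx Hgx).
  + exact (is_derive_plus (V := H_NormedModule) _ _ _ _ _ Hfy Hgy).
  + transitivity (plus (scal (1 / 2) (plus fx (mult (I : H) fy)))
      (scal (1 / 2) (plus gx (mult (I : H) gy))) : H).
    * generalize (Sph_val I); clear; Hring.
    * rewrite Ef Eg; apply (plus_zero_l (G := H_AbelianMonoid)).
Qed.

Lemma is_derive_scal_H (a : R) (f : R -> H) (x : R) (l : H) :
  is_derive (V := H_NormedModule) f x l ->
  is_derive (V := H_NormedModule) (fun t => scal a (f t)) x (scal a l).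
Proof.
intros Hf.
apply (filterdiff_ext_lin (U := R_NormedModule) (V := H_NormedModule) _ (fun t => scal a (scal t
  l))).
- exact (filterdiff_scal_r_fct (U := R_NormedModule) (V := H_NormedModule) a f _ Rmult_comm Hf).
- intros y; rewrite !(scal_assoc (V := H_ModuleSpace)); f_equal; apply Rmult_comm.
Qed.

Lemma slice_regular_scal (a : R) (f : H -> H) :
  slice_regular f -> slice_regular (fun q => scal a (f q)).
Proof.
intros [Df Rf]; split.
- intros q; destruct (Df q) as [L HL]; eexists.
  exact (filterdiff_scal_r_fct (U := H_NormedModule) (V := H_NormedModule) a f L Rmult_comm HL).
- intros I x y; destruct (Rf I x y) as (fx & fy & Hfx & Hfy & Ef).
  exists (scal a fx), (scal a fy); split; [|split].
  + exact (is_derive_scal_H a _ _ _ Hfx).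
  + exact (is_derive_scal_H a _ _ _ Hfy).
  + transitivity (scal a (scal (1 / 2) (plus fx (mult (I : H) fy))) : H).
    * generalize (Sph_val I); clear; Hring.
    * rewrite Ef; apply (scal_zero_r (V := H_ModuleSpace)).
Qed.

(** * Multiplicativity and the isomorphism *)

Section Isomorphism.

Variables I J : Sph.
Hypothesis I_orth_J : orthogonal I J.

(* Both sides are slice regular and agree on the real axis, where the star product is the
   pointwise product. *)
Lemma star_splits (f g : H -> H) (F G F' G' : CI I -> H) (p q p' q' : C -> C) :
  slice_regular f -> slice_regular g ->
  represents I F p -> represents I G q -> represents I F' p' -> represents I G' q' ->
  (forall c, f (emb I c) = sp I J (p c) (q c)) ->
  (forall c, g (emb I c) = sp I J (p' c) (q' c)) ->
  slice_regular (star f g) /\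
  splits I J (star f g)
    (fun z => plus (mult (F z) (F' z)) (opp (mult (G z) (sharp G' z))))
    (fun z => plus (mult (F z) (G' z)) (mult (G z) (sharp F' z))).
Proof.
intros Hf Hg HF HG HF' HG' Ef Eg.
assert (RU := represents_plus I _ _ _ _ (represents_mult I _ _ _ _ HF HF')
  (represents_opp I _ _ (represents_mult I _ _ _ _ HG (represents_sharp I _ _ HG')))).
assert (RV := represents_plus I _ _ _ _ (represents_mult I _ _ _ _ HF HG')
  (represents_mult I _ _ _ _ HG (represents_sharp I _ _ HF'))).
destruct (splits_surj I J I_orth_J _ _ _ _ RU RV) as [h [Hh Eh]].
destruct (slice_regular_power_series f Hf) as [a Ha], (slice_regular_power_series g Hg) as [b Hb].
destruct (slice_regular_power_series h Hh) as [d Hd].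
assert (Ed : d = conv a b).
{ apply (H_series_unique _ _ (fun x => h (RtoH x))); intros x; [apply Hd|].
  replace (h (RtoH x)) with (mult (f (RtoH x)) (g (RtoH x)) : H).
  - apply (cauchy_product a b (fun x => f (RtoH x)) (fun x => g (RtoH x))); intros y;
    [apply Ha|apply Hb].
  - rewrite -!(emb_RtoC I) Ef Eg Eh (sp_mult I J I_orth_J).
    (* At a real point [sharp] reduces to conjugation of the value, so the components of [h] become
       those given by [sp_mult]. *)
    assert (Ex : Cconj x = x) by (unfold Cconj, RtoC; simpl; f_equal; ring).
    rewrite Ex; f_equal; ring. }
assert (Es : star f g = h).
{ apply functional_extensionality; intros z; unfold star.
  rewrite (coeffE f a Ha) (coeffE g b Hb).
  apply HseriesE; change (H_series (fun n => mult (pow_n (z : H_Ring) n) (conv a b n)) (h z)).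
  rewrite -Ed; apply Hd. }
rewrite Es; split; [assumption|].
now apply (splits_sp I J h _ _ _ _ RU RV).
Qed.

Lemma Hconj_plus (p q : H) : Hconj (plus p q) = plus (Hconj p) (Hconj q).
Proof. Hring. Qed.

Lemma Hconj_mult (p q : H) : Hconj (mult p q) = mult (Hconj q) (Hconj p).
Proof. Hring. Qed.

Lemma Hconj_scal (x : R) (q : H) : Hconj (scal x q) = scal x (Hconj q).
Proof. Hring. Qed.

Lemma Hconj_opp (q : H) : Hconj (opp q) = opp (Hconj q).
Proof. Hring. Qed.

Lemma Hconj_involutive (q : H) : Hconj (Hconj q) = q.
Proof. Hring. Qed.

Lemma CI_conj_involutive (z : CI I) : CI_conj (CI_conj z) = z.
Proof. apply CI_eq, Hconj_involutive. Qed.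

Lemma emb_comm (z w : C) : mult (emb I z) (emb I w) = mult (emb I w) (emb I z).
Proof. now rewrite -!emb_mult Cmult_comm. Qed.

Lemma represents_comm (F G : CI I -> H) phi psi z w : represents I F phi -> represents I G psi ->
  mult (F z) (G w) = mult (G w) (F z).
Proof.
intros HF HG; destruct (CI_surj I z) as [c ->], (CI_surj I w) as [d ->].
rewrite (proj2 HF) (proj2 HG); apply emb_comm.
Qed.

(** The first row holds by construction. For the second, [sharp] is involutive and, like
    quaternionic conjugation, reverses products; the order is restored because all entries take
    values in the commutative [C_I]. *)
Lemma sharp_matrix_mult (F G F' G' : CI I -> H) (p q p' q' : C -> C) :
  represents I F p -> represents I G q -> represents I F' p' -> represents I G' q' ->
  sharp_matrix
    (fun z => plus (mult (F z) (F' z)) (opp (mult (G z) (sharp G' z))))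
    (fun z => plus (mult (F z) (G' z)) (mult (G z) (sharp F' z))) =
  (fun z => Mmult (sharp_matrix F G z) (sharp_matrix F' G' z)).
Proof.
intros HF HG HF' HG'; apply functional_extensionality; intros z.
assert (RF := represents_sharp I _ _ HF); assert (RG := represents_sharp I _ _ HG).
assert (RF' := represents_sharp I _ _ HF'); assert (RG' := represents_sharp I _ _ HG').
unfold sharp_matrix; rewrite mat2_mult.
assert (E1 : sharp (fun z => plus (mult (F z) (F' z)) (opp (mult (G z) (sharp G' z)))) z =
  plus (mult (opp (sharp G z)) (G' z)) (mult (sharp F z) (sharp F' z))).
{ transitivity (plus (mult (sharp F' z) (sharp F z)) (opp (mult (G' z) (sharp G z))) : H).
  - unfold sharp; rewrite CI_conj_involutive Hconj_plus Hconj_opp !Hconj_mult Hconj_involutive;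
    reflexivity.
  - rewrite (represents_comm _ _ _ _ z z RF' RF) (represents_comm _ _ _ _ z z HG' RG).
    generalize (sharp F z) (sharp F' z) (sharp G z) (G' z); clear; Hring. }
assert (E2 : opp (sharp (fun z => plus (mult (F z) (G' z)) (mult (G z) (sharp F' z))) z) =
  plus (mult (opp (sharp G z)) (F' z)) (mult (sharp F z) (opp (sharp G' z)))).
{ transitivity (opp (plus (mult (sharp G' z) (sharp F z)) (mult (F' z) (sharp G z))) : H).
  - unfold sharp; rewrite CI_conj_involutive Hconj_plus !Hconj_mult Hconj_involutive; reflexivity.
  - rewrite (represents_comm _ _ _ _ z z RG' RF) (represents_comm _ _ _ _ z z HF' RG).
    generalize (sharp F z) (sharp G' z) (sharp G z) (F' z); clear; Hring. }
rewrite E1 E2; f_equal.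
generalize (F z) (F' z) (G z) (sharp G' z); clear; Hring.
Qed.

End Isomorphism.

Theorem proposition2p10 (I J : Sph) (hIJ : orthogonal I J) :
  (* Phi maps slice regular functions into M_I *)
  (forall f : H -> H, slice_regular f -> M_ I (Phi I J f)) /\
  (* additivity *)
  (forall f g : H -> H, slice_regular f -> slice_regular g ->
     slice_regular (fun q => plus (f q) (g q)) /\
     Phi I J (fun q => plus (f q) (g q)) =
       (fun z => plus (Phi I J f z) (Phi I J g z))) /\
  (* compatibility with real scalars *)
  (forall (a : R) (f : H -> H), slice_regular f ->
     slice_regular (fun q => scal a (f q)) /\
     Phi I J (fun q => scal a (f q)) =
       (fun z => Rscal_mat a (Phi I J f z))) /\
  (* multiplicativity *)
  (forall f g : H -> H, slice_regular f -> slice_regular g ->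
     slice_regular (star f g) /\
     Phi I J (star f g) = (fun z => Mmult (Phi I J f z) (Phi I J g z))) /\
  (* injectivity *)
  (forall f g : H -> H, slice_regular f -> slice_regular g ->
     Phi I J f = Phi I J g -> f = g) /\
  (* surjectivity onto M_I *)
  (forall A : CI I -> @matrix H 2 2, M_ I A ->
     exists f : H -> H, slice_regular f /\ Phi I J f = A).
Proof.
split; [|split; [|split; [|split; [|split]]]].
- intros f Hf.
  destruct (slice_regular_splits I J hIJ f Hf) as (F & G & p & q & HF & HG & Ef).
  exists F, G; split; [apply entireP; now exists p|split; [apply entireP; now exists q|]].
  apply (PhiE I J hIJ); now apply (splits_sp I J f F G p q).
- intros f g Hf Hg; split; [now apply slice_regular_plus|].
  destruct (slice_regular_splits I J hIJ f Hf) as (F & G & p & q & HF & HG & Ef).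
  destruct (slice_regular_splits I J hIJ g Hg) as (F' & G' & p' & q' & HF' & HG' & Eg).
  assert (Sf := proj2 (splits_sp I J f F G p q HF HG) Ef).
  assert (Sg := proj2 (splits_sp I J g F' G' p' q' HF' HG') Eg).
  rewrite (PhiE I J hIJ _ _ _ Sf) (PhiE I J hIJ _ _ _ Sg).
  rewrite (PhiE I J hIJ (fun q => plus (f q) (g q)) (fun z => plus (F z) (F' z)) (fun z => plus (G
    z) (G' z))).
  + apply functional_extensionality; intros z; unfold sharp_matrix; rewrite mat2_plus; unfold sharp.
    rewrite !Hconj_plus; f_equal.
    generalize (Hconj (G (CI_conj z))) (Hconj (G' (CI_conj z))); clear; Hring.
  + apply (splits_sp I J _ _ _ _ _ (represents_plus I F F' p p' HF HF') (represents_plus I G G' q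
      q' HG HG')).
    intros c; rewrite Ef Eg; symmetry; apply sp_plus.
- intros a f Hf; split; [now apply slice_regular_scal|].
  destruct (slice_regular_splits I J hIJ f Hf) as (F & G & p & q & HF & HG & Ef).
  assert (Sf := proj2 (splits_sp I J f F G p q HF HG) Ef).
  rewrite (PhiE I J hIJ _ _ _ Sf).
  rewrite (PhiE I J hIJ (fun q => scal a (f q)) (fun z => scal a (F z)) (fun z => scal a (G z))).
  + apply functional_extensionality; intros z; unfold sharp_matrix; rewrite mat2_scal; unfold sharp.
    rewrite !Hconj_scal; f_equal.
    generalize (Hconj (G (CI_conj z))); clear; Hring.
  + apply (splits_sp I J _ _ _ _ _ (represents_scal I a F p HF) (represents_scal I a G q HG)).
    intros c; rewrite Ef; symmetry; apply sp_scal.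
- intros f g Hf Hg.
  destruct (slice_regular_splits I J hIJ f Hf) as (F & G & p & q & HF & HG & Ef).
  destruct (slice_regular_splits I J hIJ g Hg) as (F' & G' & p' & q' & HF' & HG' & Eg).
  assert (Sf := proj2 (splits_sp I J f F G p q HF HG) Ef).
  assert (Sg := proj2 (splits_sp I J g F' G' p' q' HF' HG') Eg).
  destruct (star_splits I J hIJ f g F G F' G' p q p' q') as [Hs Ss]; try assumption.
  split; [assumption|].
  rewrite (PhiE I J hIJ _ _ _ Sf) (PhiE I J hIJ _ _ _ Sg) (PhiE I J hIJ _ _ _ Ss).
  now apply (sharp_matrix_mult I F G F' G' p q p' q').
- intros f g Hf Hg E.
  destruct (slice_regular_splits I J hIJ f Hf) as (F & G & p & q & HF & HG & Ef).
  destruct (slice_regular_splits I J hIJ g Hg) as (F' & G' & p' & q' & HF' & HG' & Eg).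
  rewrite (PhiE I J hIJ _ _ _ (proj2 (splits_sp I J f F G p q HF HG) Ef)) in E.
  rewrite (PhiE I J hIJ _ _ _ (proj2 (splits_sp I J g F' G' p' q' HF' HG') Eg)) in E.
  (* It suffices to compare values at real points, and there the first rows of the two matrices
     determine them. *)
  apply slice_regular_ext; try assumption; intros x.
  rewrite -(emb_RtoC I) Ef Eg; unfold sp.
  rewrite -(proj2 HF) -(proj2 HG) -(proj2 HF') -(proj2 HG').
  destruct (mat2_inj _ _ _ _ _ _ _ _ (f_equal (fun A => A (CI_of_C I x)) E)) as [-> ->].
  reflexivity.
- intros A (U & V & HU & HV & ->).
  destruct (proj1 (entireP I U) HU) as [p Hp], (proj1 (entireP I V) HV) as [q Hq].
  destruct (splits_surj I J hIJ U V p q Hp Hq) as [f [Hf Ef]].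
  exists f; split; [assumption|].
  apply (PhiE I J hIJ); now apply (splits_sp I J f U V p q).
Qed.
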